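(* Let $(M,Z)$ be a $b$-manifold of dimension three. (1) If $X$ is a rotational Beltrami field on $M$ (with respect to some $b$-metric and some $b$-volume form) which is non-vanishing as a section of ${}^bTM$, then $X$ is, up to rescaling, the Reeb vector field of some $b$-contact form on $M$; that is, there exist a $b$-contact form $\alpha$ on $M$ with Reeb vector field $R_\alpha$ and a nowhere vanishing function $h\in C^\infty(M)$ with $X=hR_\alpha$. (2) Conversely, if $\alpha$ is a $b$-contact form on $M$ with Reeb vector field $R_\alpha$ and $h\in C^\infty(M)$ is nowhere vanishing, then $hR_\alpha$ is a rotational Beltrami field for some $b$-metric and some $b$-volume form on $M$.
   Context: A $b$-manifold $(M,Z)$ is an oriented manifold $M$ with an oriented hypersurface $Z$ (possibly $Z=\partial M$). A $b$-vector field is a vector field on $M$ tangent to $Z$ at every point of $Z$. The $b$-vector fields are the sections of a vector bundle ${}^bTM$ (the $b$-tangent bundle); near a point of $Z$, with $t$ a defining function of $Z$ and coordinates $(t,x_2,\dots,x_n)$, a local frame is $t\partial_t,\partial_{x_2},\dots,\partial_{x_n}$. The dual bundle ${}^bT^*M$ has local frame $\frac{dt}{t},dx_2,\dots,dx_n$. A $b$-form of degree $p$ is a smooth section of $\Lambda^p({}^bT^*M)$; the exterior derivative extends from ordinary forms on $M\setminus Z$. A $b$-vector field such as $t\partial_t$ may vanish on $Z$ as an ordinary vector field but be non-vanishing as a section of ${}^bTM$. A $b$-metric is a smooth positive definite bundle metric $g$ on ${}^bTM$; a $b$-volume form is a nowhere vanishing $b$-form $\mu$ of top degree (it need not be the volume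 form induced by $g$). Rotational Beltrami field: given a $b$-metric $g$ and a $b$-volume form $\mu$ on a three-dimensional $b$-manifold, a $b$-vector field $X$ is a rotational Beltrami field if, with $\alpha=g(X,\cdot)$, one has $d\alpha=f\,\iota_X\mu$ and $d\iota_X\mu=0$ for some nowhere vanishing $f\in C^\infty(M)$. $b$-contact form (dimension three): a $b$-form $\alpha$ of degree one with $\alpha\wedge d\alpha\neq 0$ everywhere as a section of $\Lambda^3({}^bT^*M)$. Its Reeb vector field $R_\alpha$ is the unique $b$-vector field with $\iota_{R_\alpha}d\alpha=0$ and $\alpha(R_\alpha)=1$. *)

(* Defs.v *)
From HB Require Import structures.
From mathcomp Require Import all_boot all_order all_algebra all_fingroup.
From mathcomp Require Import all_classical all_reals all_analysis.
Import Order.TTheory GRing.Theory Num.Theory.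
Import numFieldNormedType.Exports.

Set Implicit Arguments.
Unset Strict Implicit.
Unset Printing Implicit Defensive.

Local Open Scope classical_set_scope.
Local Open Scope ring_scope.

Section SmoothFunctions.
Variable R : realType.
Implicit Types (F u : 'rV[R]_3 -> R) (i : 'I_3).

Definition pderiv i F : 'rV[R]_3 -> R := fun x => 'D_(delta_mx 0 i) F x.

Definition iter_pderiv (s : seq 'I_3) F : 'rV[R]_3 -> R := foldr pderiv F s.

Definition smooth_open (W : set 'rV[R]_3) F : Prop :=
  forall s : seq 'I_3, forall x, W x ->
    {for x, continuous (iter_pderiv s F)} /\
    (forall i, derivable (iter_pderiv s F) x (delta_mx 0 i)).

(* On a set that need not be open (a chart at the boundary), smooth means
   locally the restriction of a smooth function on an open set. *)
Definition smooth_on (V : set 'rV[R]_3) u : Prop :=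
  forall x, V x -> exists W : set 'rV[R]_3, exists F,
    [/\ open W, W x, smooth_open W F & {in W `&` V, F =1 u}].

End SmoothFunctions.

(* A three-dimensional b-manifold (M, Z), presented by an atlas of charts
   adapted to Z: in each chart (U, phi), with coordinates (t, x1, x2) = phi,
   Z is the locus t = 0.  (A chart disjoint from Z is taken with t <> 0 on it.)
   A chart with [half] set takes values in the half-space t >= 0, so that the
   boundary of M is contained in Z; [half = xpred0] gives a hypersurface in a
   manifold without boundary and [half = xpredT] gives Z = \partial M.
   [psi] is a total function inverse to [phi] on phi(U).
   The orientations of M and Z are given by the sign of each chart, and of
   its restriction (x1, x2) to Z. *)
Section BManifold.
Variable R : realType.

Definition half_space (b : bool) : set 'rV[R]_3 :=
  [set x | b -> 0 <= x 0 ord0].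

Definition transition_mx (T : Type) (phi : T -> 'rV[R]_3)
    (phi' : T -> 'rV[R]_3) (psi : 'rV[R]_3 -> T) (p : T) : 'M[R]_3 :=
  \matrix_(i, j) pderiv j (fun x => phi' (psi x) 0 i) (phi p).

(* M is oriented by its transition Jacobians off Z; by density of M \ Z and
   invertibility these then have the same sign on Z, where the t-derivative of
   a function defined only for t >= 0 is not given by [pderiv].  On Z the
   derivatives along x1 and x2 are tangent to Z and cause no such problem. *)
Record bmanifold3 := BManifold3 {
  space :> topologicalType;
  hypersurface : set space;
  chart : Type;
  dom : chart -> set space;
  half : chart -> bool;
  phi : chart -> space -> 'rV[R]_3;
  psi : chart -> 'rV[R]_3 -> space;
  signM : chart -> bool;
  signZ : chart -> bool;
  bm_hausdorff : hausdorff_space space;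
  bm_second_countable : @second_countable space;
  bm_cover : forall p, exists c, dom c p;
  bm_dom_open : forall c, open (dom c);
  bm_image : forall c, exists2 O, open O &
    phi c @` dom c = O `&` half_space (half c);
  bm_phi_continuous : forall c, {within dom c, continuous (phi c)};
  bm_psi_continuous : forall c,
    {within phi c @` dom c, continuous (psi c)};
  bm_phiK : forall c, {in dom c, cancel (phi c) (psi c)};
  bm_transition_smooth : forall c c' i,
    smooth_on (phi c @` (dom c `&` dom c')) (fun x => phi c' (psi c x) 0 i);
  bm_hypersurface : forall c p, dom c p ->
    hypersurface p <-> phi c p 0 ord0 = 0;
  bm_orientedM : forall c c' p, dom c p -> dom c' p -> ~ hypersurface p ->
    0 < (-1) ^+ (signM c (+) signM c')
        * \det (transition_mx (phi c) (phi c') (psi c) p);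
  bm_orientedZ : forall c c' p, dom c p -> dom c' p -> hypersurface p ->
    0 < (-1) ^+ (signZ c (+) signZ c')
        * \det (row' ord0 (col' ord0
            (transition_mx (phi c) (phi c') (psi c) p)))
}.

End BManifold.

(* Sections of bundles associated to the b-tangent bundle are given, in each
   chart c, by their coefficients with respect to the local frame
   e_0 = t d/dt, e_1 = d/dx1, e_2 = d/dx2 and its dual dt/t, dx1, dx2.
   The coefficients are functions on M whose values matter only on [dom c]. *)
Section BGeometry.
Variables (R : realType) (M : bmanifold3 R).
Local Notation C := (chart M).
Implicit Types (c : C) (p : M) (i j : 'I_3).

Definition smooth_in c (u : M -> R) : Prop :=
  smooth_on (phi c @` dom c) (u \o psi c).

Definition smooth (u : M -> R) : Prop := forall c, smooth_in c u.

Definition nowhere_zero (u : M -> R) : Prop := forall p, u p != 0.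

(* e_i = bweight c i * d/dx_i *)
Definition bweight c i p : R := if i == ord0 then phi c p 0 ord0 else 1.

(* e_i(u) in the chart c.  At a boundary point the t-derivative of u \o psi c is
   not meaningful, but it is multiplied by t = 0, which gives the right value
   of t du/dt for u smooth up to the boundary. *)
Definition bderiv c i (u : M -> R) p : R :=
  bweight c i p * pderiv i (u \o psi c) (phi c p).

(* Off Z, the matrix sending the components of a tangent vector in the frame
   of c to those in the frame of c'. *)
Definition btransition c c' p : 'M[R]_3 :=
  \matrix_(i, j) ((bweight c' i p)^-1
    * transition_mx (phi c) (phi c') (psi c) p i j * bweight c j p).

(* The predicate P c c' p for the overlaps off Z.  As M \ Z is dense and the
   frames and coefficients are smooth up to Z, local sections that agree off Z
   agree as sections of the bundle. *)
Definition on_overlaps (P : C -> C -> M -> Prop) : Prop :=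
  forall c c' p, dom c p -> dom c' p -> ~ hypersurface p -> P c c' p.

Definition bvector := C -> M -> 'cV[R]_3.

Definition is_bvector_field (X : bvector) : Prop :=
  (forall c i, smooth_in c (fun p => X c p i 0)) /\
  on_overlaps (fun c c' p => X c' p = btransition c c' p *m X c p).

Definition bvf_nonvanishing (X : bvector) : Prop :=
  forall c p, dom c p -> X c p != 0.

(* The coefficient at s = (i_1, .., i_k) is the value on (e_i_1, .., e_i_k). *)
Definition bcoef (k : nat) := C -> M -> k.-tuple 'I_3 -> R.

Definition is_bform k (w : bcoef k) : Prop :=
  [/\ forall c s, smooth_in c (fun p => w c p s),
      forall c p s (sg : 'S_k), dom c p ->
        w c p [tuple tnth s (sg a) | a < k] = (-1) ^+ sg * w c p s &
      on_overlaps (fun c c' p => forall s, w c p s =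
        \sum_(r : k.-tuple 'I_3)
          w c' p r * \prod_(a < k) btransition c c' p (tnth r a) (tnth s a))].

Definition bform_eq k (w w' : bcoef k) : Prop :=
  forall c p, dom c p -> forall s, w c p s = w' c p s.

Definition bform_nowhere_zero k (w : bcoef k) : Prop :=
  forall c p, dom c p -> exists s, w c p s != 0.

Definition bzero k : bcoef k := fun _ _ _ => 0.

Definition bscale k (u : M -> R) (w : bcoef k) : bcoef k :=
  fun c p s => u p * w c p s.

Definition omit k (s : k.+1.-tuple 'I_3) (a : 'I_k.+1) : k.-tuple 'I_3 :=
  [tuple tnth s (lift a b) | b < k].

(* The invariant formula for the exterior derivative on (e_0, e_1, e_2); the
   bracket terms vanish because these fields commute. *)
Definition bd k (w : bcoef k) : bcoef k.+1 := fun c p s =>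
  \sum_(a < k.+1) (-1) ^+ a * bderiv c (tnth s a) (fun q => w c q (omit s a)) p.

Definition binterior k (X : bvector) (w : bcoef k.+1) : bcoef k :=
  fun c p s => \sum_(i < 3) X c p i 0 * w c p [tuple of i :: s].

Definition bwedge1 k (al : bcoef 1) (w : bcoef k) : bcoef k.+1 := fun c p s =>
  \sum_(a < k.+1) (-1) ^+ a * al c p [tuple tnth s a] * w c p (omit s a).

Definition bpairing (al : bcoef 1) (X : bvector) c p : R :=
  \sum_(i < 3) al c p [tuple i] * X c p i 0.

Definition bbilinear := C -> M -> 'M[R]_3.

Definition is_bmetric (g : bbilinear) : Prop :=
  [/\ forall c i j, smooth_in c (fun p => g c p i j),
      forall c p, dom c p -> (g c p)^T = g c p,
      forall c p, dom c p ->
        forall v : 'cV[R]_3, v != 0 -> 0 < (v^T *m g c p *m v) 0 0 &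
      on_overlaps (fun c c' p =>
        g c p = (btransition c c' p)^T *m g c' p *m btransition c c' p)].

Definition is_bvolume (mu : bcoef 3) : Prop :=
  is_bform mu /\ bform_nowhere_zero mu.

(* g(X, .) *)
Definition flat (g : bbilinear) (X : bvector) : bcoef 1 :=
  fun c p s => ((X c p)^T *m g c p) 0 (thead s).

Definition rotational_beltrami (g : bbilinear) (mu : bcoef 3) (X : bvector) :
    Prop :=
  is_bvector_field X /\
  exists f : M -> R, [/\ smooth f, nowhere_zero f,
    bform_eq (bd (flat g X)) (bscale f (binterior X mu)) &
    bform_eq (bd (binterior X mu)) (@bzero 3)].

Definition bcontact (al : bcoef 1) : Prop :=
  is_bform al /\ bform_nowhere_zero (bwedge1 al (bd al)).

Definition is_reeb (al : bcoef 1) (X : bvector) : Prop :=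
  [/\ is_bvector_field X,
      bform_eq (binterior X (bd al)) (@bzero 1) &
      forall c p, dom c p -> bpairing al X c p = 1].

Definition bvf_scale (h : M -> R) (X : bvector) : bvector :=
  fun c p => h p *: X c p.

Definition bvf_eq (X Y : bvector) : Prop :=
  forall c p, dom c p -> X c p = Y c p.

End BGeometry.

(* Main.v *)
(* Write [t] for the coordinate that cuts out [Z].

   A rotational Beltrami field [X] with [alpha = g(X, .)] and
   [d alpha = f i_X mu] satisfies
   [alpha /\ d alpha = f alpha(X) mu] with [alpha(X) = g(X, X) > 0], so [alpha] is
   [b]-contact; as [i_X d alpha = 0], its Reeb field is [X / g(X, X)].

   Conversely, put [mu = (alpha /\ d alpha) / h] and
   [g = alpha^2 / |h| + g0 o pi], where [pi = id - R (x) alpha] is the projection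
   onto [ker alpha] and [g0] is any [b]-metric.  Then
   [g(h R, .) = sgn(h) alpha] and [i_(h R) mu = d alpha], so [f = sgn h] works.

   It remains that a [b]-metric [g0] exists.  In one chart take the metric that
   makes the [b]-frame orthonormal; it is smooth in any other chart because the
   transition matrices of the [b]-frames extend smoothly over [Z]: by Hadamard's
   lemma [t' = t G] with [G] smooth and nonzero, so
   [dt'/t' = dt/t + dG/G].  These local metrics are added up with weights that are
   locally finite. *)
From HB Require Import structures.
From mathcomp Require Import all_boot all_order all_algebra all_fingroup.
From mathcomp Require Import all_classical all_reals all_analysis.
From mathcomp Require Import ring lra.
Require Import Defs.
Import Order.TTheory GRing.Theory Num.Theory.
Import numFieldNormedType.Exports.

Set Implicit Arguments.
Unset Strict Implicit.
Unset Printing Implicit Defensive.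

Local Open Scope classical_set_scope.
Local Open Scope ring_scope.

(** * Smooth germs *)

(** Smoothness is given by iterated partial derivatives along the axes, so total differentiability,
    the chain rule and the symmetry of second derivatives have to be won from the mean value theorem
    before charts can be compared. Two facts govern the behaviour at [Z]. A smooth function on a
    chart is locally the restriction of a smooth [F] on an open set, and [e_0 = t d/dt] vanishes at
    [t = 0], so frame derivatives do not depend on the extension even at a boundary point. Frame
    changes are prescribed only off [Z]; as the complement is dense, an identity between continuous
    functions passes to [Z]. That [d alpha] obeys the transformation rule rests on the closedness of
    the dual frame of the other chart. The sum of local metrics needs no normalisation: semidefinite
    terms with nonnegative weights add up to a definite one as soon as one term is definite. [sgn h]
    is smooth since it is locally constant, and [i_(h R) mu = d alpha] turns the second Beltrami
    equation into [d d alpha = 0]. *)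

Section Germs.
Variable R : realType.
Local Notation E := 'rV[R]_3.
Implicit Types (F G : E -> R) (x y : E) (i j : 'I_3) (n : nat).

(** Each order asks for its properties near [x], not only at [x], so that conditions of this kind
    can be transferred between germs. Continuity is demanded at every order because derivability
    along the axes does not imply it. *)
Fixpoint Cn n F x : Prop :=
  (\forall y \near x, {for y, continuous F}) /\
  if n is m.+1 then
    (\forall y \near x, forall i, derivable F y (delta_mx 0 i)) /\
    forall i, Cn m (pderiv i F) x
  else True.

Definition smooth_at F x := forall n, Cn n F x.

(** In [smooth_at] the neighbourhood may shrink as the order grows; here one neighbourhood serves
    all orders, as in [smooth_open]. *)
Definition smooth_near F x := \forall y \near x, smooth_at F y.

Lemma Cn_continuous n F x : Cn n F x -> \forall y \near x, {for y, continuous F}.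
Proof. by case: n => [|n] []. Qed.

Lemma CnW n F x : Cn n.+1 F x -> Cn n F x.
Proof.
elim: n F => [|n IH] F [cF [dF pF]]; split=> //.
by split=> // i; apply: IH; exact: pF.
Qed.

Lemma pderiv_near F G x i : {near x, F =1 G} -> {near x, pderiv i F =1 pderiv i G}.
Proof.
move=> /near_join FG; apply: filterS FG => y FG.
exact: near_eq_derive.
Qed.

Lemma continuous_near F G x : {near x, F =1 G} ->
  {for x, continuous F} -> {for x, continuous G}.
Proof.
move=> FG cF; rewrite /prop_for /continuous_at -(nbhs_singleton FG).
exact: cvg_trans (near_eq_cvg FG) cF.
Qed.

Lemma Cn_near n F G x : {near x, F =1 G} -> Cn n F x -> Cn n G x.
Proof.
elim: n F G => [|n IH] F G FG [cF].
  move=> _; split=> //.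
  by move/near_join : FG; apply: filterS2 cF => y; move=> + h; exact: continuous_near.
move=> [dF pF]; split; last split.
- by move/near_join : FG; apply: filterS2 cF => y; move=> + h; exact: continuous_near.
- move/near_join : FG; apply: filterS2 dF => y dF FG i.
  exact: near_eq_derivable (dF i).
- by move=> i; apply: IH (pF i); exact: pderiv_near.
Qed.

Lemma smooth_near_at F x : smooth_near F x -> smooth_at F x.
Proof. exact: nbhs_singleton. Qed.

Lemma smooth_at_pderiv F x i : smooth_at F x -> smooth_at (pderiv i F) x.
Proof. by move=> sF n; case: (sF n.+1) => _ [_]; exact. Qed.

Lemma smooth_near_pderiv F x i : smooth_near F x -> smooth_near (pderiv i F) x.
Proof. by apply: filterS => y; exact: smooth_at_pderiv. Qed.

Lemma smooth_at_continuous F x : smooth_at F x -> {for x, continuous F}.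
Proof. by move=> /(_ 0%N) [] /nbhs_singleton. Qed.

Lemma smooth_at_derivable F x i : smooth_at F x -> derivable F x (delta_mx 0 i).
Proof. by move=> /(_ 1%N) [_ [] /nbhs_singleton + _]; exact. Qed.

Lemma iter_pderiv_rcons (s : seq 'I_3) i F :
  iter_pderiv (rcons s i) F = iter_pderiv s (pderiv i F).
Proof. by rewrite /iter_pderiv foldr_rcons. Qed.

Lemma smooth_openP (W : set E) F : open W ->
  smooth_open W F <-> (forall x, W x -> smooth_at F x).
Proof.
move=> oW; split.
  move=> sF x Wx n; elim: n F sF => [|n IH] F sF; split=> //.
  - by apply: filterS (open_nbhs_nbhs (conj oW Wx)) => y Wy; case: (sF [::] y Wy).
  - by apply: filterS (open_nbhs_nbhs (conj oW Wx)) => y Wy; case: (sF [::] y Wy).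
  - split.
      by apply: filterS (open_nbhs_nbhs (conj oW Wx)) => y Wy; case: (sF [::] y Wy).
    move=> i; apply: IH => s y Wy; rewrite -iter_pderiv_rcons; exact: sF.
(* Induction from the end of the list: its last entry is the derivative taken first, so the
   induction hypothesis applies to [pderiv i F]. *)
move=> sF s; elim/last_ind: s F sF => [|s i IH] F sF x Wx.
  split; first exact/smooth_at_continuous/sF.
  by move=> i; exact/smooth_at_derivable/sF.
rewrite iter_pderiv_rcons; apply: IH Wx => y Wy; exact/smooth_at_pderiv/sF.
Qed.

Lemma smooth_nearP F x : smooth_near F x <->
  exists W : set E, [/\ open W, W x & smooth_open W F].
Proof.
split; last first.
  move=> [W [oW Wx /(smooth_openP _ oW) sF]].
  by apply: filterS (open_nbhs_nbhs (conj oW Wx)).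
rewrite /smooth_near -nbhs_nearE nbhsE => -[W [oW Wx] sF]; exists W; split=> //.
exact/smooth_openP.
Qed.

Lemma Cn_cst n (a : R) x : Cn n (cst a) x.
Proof.
have c (b : R) : \forall y \near x, {for y, continuous (cst b : E -> R)}.
  by apply: (@nearW _ (nbhs x)) => y; exact: (@cst_continuous E R b).
elim: n a => [|n IH] a; split=> //.
split; first by apply: (@nearW _ (nbhs x)) => y i; exact: derivable_cst.
move=> i; apply: Cn_near (IH 0); apply: (@nearW _ (nbhs x)) => y /=.
by rewrite /pderiv derive_cst.
Qed.

Lemma is_derive_coord x (v : E) j : is_derive x v (fun y : E => y 0 j) (v 0 j).
Proof.
have dc : differentiable (fun y : E => y 0 j) x by exact: differentiable_coord.
apply: DeriveDef; first exact: diff_derivable.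
have [dx dv] : derivable (fun y : E => y) x v /\ 'D_v (fun y : E => y) x = v.
  by split; [exact: derivable_id | exact: derive_id].
by have := derive_mx dx; rewrite dv => /matrixP/(_ 0 j); rewrite mxE => <-.
Qed.

Lemma pderiv_coord i j x : pderiv i (fun y : E => y 0 j) x = (j == i)%:R.
Proof.
by rewrite /pderiv (derive_val (is_derive := is_derive_coord _ _ _)) mxE eqxx.
Qed.

Lemma Cn_coord n j x : Cn n (fun y : E => y 0 j) x.
Proof.
have c : \forall y \near x, {for y, continuous (fun y : E => y 0 j)}.
  by apply: (@nearW _ (nbhs x)) => y; exact: coord_continuous.
case: n => [|n]; split=> //; split.
  by apply: (@nearW _ (nbhs x)) => y i; exact: (ex_derive (is_derive := is_derive_coord _ _ _)).
move=> i; apply: Cn_near (@Cn_cst n ((j == i)%:R) x).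
by apply: (@nearW _ (nbhs x)) => y /=; rewrite pderiv_coord.
Qed.

Lemma CnD n F G x : Cn n F x -> Cn n G x -> Cn n (fun y => F y + G y) x.
Proof.
elim: n F G => [|n IH] F G [cF +] [cG +].
  by move=> _ _; split=> //; apply: filterS2 cF cG => y; exact: continuousD.
move=> [dF pF] [dG pG]; split; first by apply: filterS2 cF cG => y; exact: continuousD.
split; first by apply: filterS2 dF dG => y dF dG i; exact: (derivableD (dF i)).
move=> i; apply: Cn_near (IH _ _ (pF i) (pG i)).
apply: filterS2 dF dG => y dF dG /=; exact/esym/deriveD.
Qed.

Lemma CnM n F G x : Cn n F x -> Cn n G x -> Cn n (fun y => F y * G y) x.
Proof.
elim: n F G => [|n IH] F G.
  move=> [cF _] [cG _]; split=> //; apply: filterS2 cF cG => y; exact: continuousM.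
move=> F1 G1; have Fn := CnW F1; have Gn := CnW G1.
move: F1 G1 => [cF [dF pF]] [cG [dG pG]].
split; first by apply: filterS2 cF cG => y; exact: continuousM.
split; first by apply: filterS2 dF dG => y dF dG i; exact: (derivableM (dF i)).
move=> i; apply: Cn_near (CnD (IH _ _ Fn (pG i)) (IH _ _ Gn (pF i))).
apply: filterS2 dF dG => y dF dG /=; exact/esym/deriveM.
Qed.

Lemma CnV n F x : F x != 0 -> Cn n F x -> Cn n (fun y => (F y)^-1) x.
Proof.
elim: n F => [|n IH] F Fx0.
  move=> [cF _]; split=> //.
  have /(_ (nbhs_singleton cF)) F0 : {for x, continuous F} -> \forall y \near x, F y != 0.
    by move=> c; apply: (c [set r | r != 0]); apply: open_nbhs_nbhs; split => //; exact: open_neq.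
  by apply: filterS2 cF F0 => y cF F0; exact: continuousV.
move=> F1; have Fn := CnW F1; case: F1 => cF [dF pF].
have F0 : \forall y \near x, F y != 0.
  apply: (nbhs_singleton cF [set r | r != 0]).
  by apply: open_nbhs_nbhs; split => //; exact: open_neq.
split; first by apply: filterS2 cF F0 => y cF F0; exact: continuousV.
split.
  apply: filterS2 dF F0 => y dF F0 i; exact: (@derivableV _ _ F).
move=> i; have FV := IH _ Fx0 Fn.
apply: Cn_near (CnM (CnM (Cn_cst n (-1) x) (CnM FV FV)) (pF i)).
apply: filterS2 dF F0 => y dF F0 /=.
rewrite /pderiv (@deriveV _ _ F)//= -exprVn expr2 mulN1r; exact: erefl.
Qed.

End Germs.

(** * Continuously differentiable functions *)

Section PartialDerivatives.
Variable R : realType.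
Local Notation E := 'rV[R]_3.
Implicit Types (F G : E -> R) (x y z : E) (i j : 'I_3) (n : nat).

(** Both difference quotients are equal as functions of the increment. This turns directional
    derivatives into derivatives in one variable. *)
Lemma derivable_lineE (W : normedModType R) (V : normedModType R)
    (F : V -> W) (z v : V) (t : R) :
  (derivable (fun h : R => F (z + h *: v)) t 1 <-> derivable F (z + t *: v) v) /\
  'D_1 (fun h : R => F (z + h *: v)) t = 'D_v F (z + t *: v).
Proof.
rewrite /derivable /derive; set g1 := fun h => h^-1 *: _; set g2 := fun h => h^-1 *: _.
suff -> : g1 = g2 by [].
rewrite funeqE /g1 /g2 => h /=; congr (_ *: (F _ - _)).
by rewrite [h *: 1]mulr1 scalerDl addrCA.
Qed.

Lemma is_derive_line (W : normedModType R) (V : normedModType R)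
    (F : V -> W) (z v : V) (t : R) : derivable F (z + t *: v) v ->
  is_derive t 1 (fun h : R => F (z + h *: v)) ('D_v F (z + t *: v)).
Proof.
by case: (derivable_lineE F z v t) => h1 h2 h; apply: DeriveDef => //; apply/h1.
Qed.

Lemma partial_MVT F z i (s : R) :
  (forall t : R, `|t| <= `|s| -> derivable F (z + t *: delta_mx 0 i) (delta_mx 0 i)) ->
  exists2 t : R, `|t| <= `|s| &
    F (z + s *: delta_mx 0 i) - F z = pderiv i F (z + t *: delta_mx 0 i) * s.
Proof.
move=> dF; set e := delta_mx 0 i in dF *.
pose f h := F (z + h *: e).
have df (t : R) : `|t| <= `|s| -> is_derive t 1 f (pderiv i F (z + t *: e)).
  by move=> ts; apply: is_derive_line; exact: dF.
have f0 : f 0 = F z by rewrite /f scale0r addr0.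
have [s0|s0] := leP 0 s.
  have ts (t : R) : t \in `[0, s] -> `|t| <= `|s|.
    by rewrite in_itv /= => /andP[t0 ts]; rewrite !ger0_norm.
  have [||t tI] := @MVT_segment R f (fun t : R => pderiv i F (z + t *: e)) 0 s s0.
  - move=> t tI; apply: df; apply: ts; exact: subset_itv_oo_cc tI.
  - apply: derivable_within_continuous => t tI; exact: (ex_derive (is_derive := df _ (ts _ tI))).
  - by rewrite f0 subr0 => h; exists t => //; exact: ts.
have ts (t : R) : t \in `[s, 0] -> `|t| <= `|s|.
  by rewrite in_itv /= => /andP[t0 ts]; rewrite !ler0_norm ?lerN2// ltW.
have [||t tI] := @MVT_segment R f (fun t : R => pderiv i F (z + t *: e)) s 0 (ltW s0).
- move=> t tI; apply: df; apply: ts; exact: subset_itv_oo_cc tI.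
- apply: derivable_within_continuous => t tI; exact: (ex_derive (is_derive := df _ (ts _ tI))).
- rewrite f0 sub0r mulrN => /eqP; rewrite -eqr_oppLR opprB => /eqP h.
  by exists t => //; exact: ts.
Qed.

Lemma normr_coord x i : `|x 0 i| <= `|x|.
Proof.
rewrite [leRHS]/Num.norm/= mx_normrE.
by rewrite -[leLHS]/((fun ij : 'I_1 * 'I_3 => `|x ij.1 ij.2|) (0, i)); exact: le_bigmax.
Qed.

Lemma normr_rV_le x (a : R) : 0 <= a -> (forall i, `|x 0 i| <= a) -> `|x| <= a.
Proof.
move=> a0 xa; rewrite [leLHS]/Num.norm/= mx_normrE.
by apply: bigmax_le => // -[k i] _ /=; rewrite ord1.
Qed.

Lemma norm_delta i : `|delta_mx 0 i : E| = 1.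
Proof.
apply/eqP; rewrite eq_le; apply/andP; split.
  by apply: normr_rV_le => // j; rewrite mxE eqxx; case: eqP => _ /=; rewrite ?normr1 ?normr0.
by have := normr_coord (delta_mx 0 i) i; rewrite mxE !eqxx normr1.
Qed.

Lemma ord3P (P : 'I_3 -> Prop) : P 0 -> P 1 -> P 2 -> forall i, P i.
Proof.
move=> P0 P1 P2 [[|[|[|//]]] Hi].
- by rewrite (_ : Ordinal _ = 0) //; exact/val_inj.
- by rewrite (_ : Ordinal _ = 1) //; exact/val_inj.
- by rewrite (_ : Ordinal _ = 2) //; exact/val_inj.
Qed.

Lemma sum3E (V : zmodType) (f : 'I_3 -> V) : \sum_i f i = f 0 + f 1 + f 2.
Proof.
rewrite !big_ord_recl big_ord0 addr0 addrA.
by congr (f _ + f _ + f _); exact/val_inj.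
Qed.

Lemma norm_rV3_le (a b c m : R) : `|a| <= m -> `|b| <= m -> `|c| <= m ->
  `|a *: delta_mx 0 0 + b *: delta_mx 0 1 + c *: delta_mx 0 2 : E| <= m.
Proof.
move=> am bm cm; apply: normr_rV_le; first exact: le_trans am.
by apply: ord3P; rewrite !mxE /= !(mulr1, mulr0, addr0, add0r).
Qed.

Lemma rV3_sum x :
  x = x 0 0 *: delta_mx 0 0 + x 0 1 *: delta_mx 0 1 + x 0 2 *: delta_mx 0 2.
Proof.
by rewrite {1}(row_sum_delta x) sum3E.
Qed.

(** The displacement [k] is run through as three axis-parallel segments, with the one-variable mean
    value theorem on each. Since the norm is the maximum of the coordinates, no intermediate point
    is farther from [x] than [|k|]. *)
Lemma rV3_MVT F x (k : E) :
  (forall y, `|y - x| <= `|k| -> forall i, derivable F y (delta_mx 0 i)) ->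
  exists2 w : 'I_3 -> E, (forall i, `|w i - x| <= `|k|) &
    F (x + k) - F x = \sum_i pderiv i F (w i) * k 0 i.
Proof.
move=> dF.
have k0 i (a : R) : `|a| <= `|k 0 i| -> `|a| <= `|k|.
  by move=> h; exact: le_trans h (normr_coord k i).
have xw (w : E) : `|w| <= `|k| -> `|x + w - x| <= `|k| by rewrite addrC addKr.
set e0' := delta_mx 0 0 : E; set e1' := delta_mx 0 1 : E; set e2' := delta_mx 0 2 : E.
have p0 (t : R) : `|t| <= `|k 0 0| -> `|x + t *: e0' - x| <= `|k|.
  move=> /k0 tk; apply: xw.
  by have := @norm_rV3_le t 0 0 `|k|; rewrite normr0 !scale0r !addr0; apply.
have p1 (t : R) : `|t| <= `|k 0 1| -> `|x + k 0 0 *: e0' + t *: e1' - x| <= `|k|.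
  move=> /k0 tk; rewrite -(addrA x); apply: xw.
  have := @norm_rV3_le (k 0 0) t 0 `|k|; rewrite normr0 !scale0r !addr0; apply=> //.
  exact: (k0 0).
have p2 (t : R) : `|t| <= `|k 0 2| ->
    `|x + k 0 0 *: e0' + k 0 1 *: e1' + t *: e2' - x| <= `|k|.
  move=> /k0 tk; rewrite -2!(addrA x); apply: xw.
  by apply: norm_rV3_le => //; [exact: (k0 0)|exact: (k0 1)].
have [t0 /p0 b0 E0] := @partial_MVT F x 0 (k 0 0) (fun t h => dF _ (p0 t h) 0).
have [t1 /p1 b1 E1] := @partial_MVT F _ 1 (k 0 1) (fun t h => dF _ (p1 t h) 1).
have [t2 /p2 b2 E2] := @partial_MVT F _ 2 (k 0 2) (fun t h => dF _ (p2 t h) 2).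
exists (fun i => if i == 0 then x + t0 *: e0' else
  if i == 1 then x + k 0 0 *: e0' + t1 *: e1'
  else x + k 0 0 *: e0' + k 0 1 *: e1' + t2 *: e2').
  by apply: ord3P.
rewrite sum3E /= -E0 -E1 -E2 {1}(rV3_sum k) 2!(addrA x).
have tele (a b c d : R) : d - a = (b - a) + (c - b) + (d - c) by ring.
exact: tele.
Qed.

(** Bounded partial derivatives give a Lipschitz estimate at [x]. For parameter integrals such a
    bound is at hand before their continuity is. *)
Lemma bounded_pderiv_continuous F x (m : R) :
  (\forall y \near x, forall i, derivable F y (delta_mx 0 i) /\ `|pderiv i F y| <= m) ->
  {for x, continuous F}.
Proof.
move=> dF.
have m0 : 0 <= m.
  by have [_] := nbhs_singleton dF 0; exact: le_trans.
apply/(@cvgrPdist_le _ _ _ (nbhs x)) => e e0.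
have [d /= d0 xd] := (nbhs_ballP x _).1 dF.
(* [m * 3] is the Lipschitz constant, one [m] per axis; the [+ 1] keeps the divisor positive when
   [m = 0]. *)
apply/(nbhs_ballP x); exists (Num.min d (e / (m * 3 + 1))) => /=.
  by rewrite lt_min d0 divr_gt0// ltr_wpDl// mulr_ge0.
move=> y; rewrite -ball_normE /= lt_min distrC => /andP[yd ye].
have xd' z : `|z - x| <= `|y - x| -> ball x d z.
  by move=> zy; rewrite -ball_normE /= distrC (le_lt_trans zy).
have [z /xd'/xd h i|w /(_ _)/xd'/xd wm] := @rV3_MVT F x (y - x).
  by case: (h i).
rewrite (addrC x) subrK distrC => ->; rewrite sum3E.
have est i : `|pderiv i F (w i) * (y - x) 0 i| <= m * `|y - x|.
  by rewrite normrM ler_pM//; [case: (wm i i)|exact: normr_coord].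
have -> : e = e / (m * 3 + 1) * (m * 3 + 1) by rewrite mulfVK// lt0r_neq0// ltr_wpDl// mulr_ge0.
apply: (@le_trans _ _ (`|y - x| * (m * 3 + 1))); last first.
  by rewrite ler_wpM2r ?addr_ge0 ?mulr_ge0// ltW.
apply: (@le_trans _ _ (m * `|y - x| + m * `|y - x| + m * `|y - x|)).
  by do 2!(apply: le_trans (ler_normD _ _) (lerD _ _); last exact: est).
have := normr_ge0 (y - x); lra.
Qed.

Lemma C1_estimate F x (e : R) : 0 < e ->
  (\forall y \near x, forall i, derivable F y (delta_mx 0 i)) ->
  (forall i, {for x, continuous (pderiv i F)}) ->
  \forall k \near (0 : E),
    `|F (x + k) - F x - \sum_i pderiv i F x * k 0 i| <= e * `|k|.
Proof.
move=> e0 dF cF.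
have : \forall y \near x, (forall i, derivable F y (delta_mx 0 i)) /\
    forall i, `|pderiv i F x - pderiv i F y| <= e / 3.
  apply: filterS2 dF (_ : \forall y \near x, forall i, _) => [y|]; first exact: conj.
  apply: (@filter_forall _ _ _ (nbhs x)) => i.
  by have /cvgrPdist_le/(_ (e / 3)) := cF i; apply; rewrite divr_gt0.
move=> /(nbhs_ballP x)[r /= r0 xr].
near=> k.
have kr : `|k| < r by near: k; move: (@pseudometric_normed_Zmodule.nbhs0_lt R E r r0).
have xk y : `|y - x| <= `|k| -> ball x r y.
  by move=> h; rewrite -ball_normE /= distrC (le_lt_trans h).
have [y /xk/xr[]//|w /(_ _)/xk/xr wk ->] := @rV3_MVT F x k.
rewrite !sum3E.
have est i : `|pderiv i F (w i) * k 0 i - pderiv i F x * k 0 i| <= e / 3 * `|k|.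
  by rewrite -mulrBl normrM distrC ler_pM//; [case: (wk i)|exact: normr_coord].
rewrite !opprD addrACA (addrACA _ _ (- _)).
rewrite (_ : e * _ = e / 3 * `|k| + e / 3 * `|k| + e / 3 * `|k|); last by field.
by do 2!(apply: le_trans (ler_normD _ _) (lerD _ _); last exact: est).
Unshelve. all: by end_near. Qed.

(** [C1_estimate] exhibits the linear map [L] formed from the partial derivatives as the first-order
    part of [F] up to a little-o, which forces [L] to be the differential. *)
Lemma C1_differentiable F x :
  (\forall y \near x, forall i, derivable F y (delta_mx 0 i)) ->
  (forall i, {for x, continuous (pderiv i F)}) ->
  differentiable F x /\
  forall v : E, 'D_v F x = \sum_i pderiv i F x * v 0 i.
Proof.
move=> dF cF.
pose L (v : E) := \sum_i pderiv i F x * v 0 i.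
have linL : linear L.
  move=> a u v; rewrite /L scaler_sumr -big_split; apply: eq_bigr => i _ /=.
  by rewrite !mxE mulrDr mulrCA.
pose Lm := GRing.isLinear.Build R E R _ L linL.
pose lL : {linear E -> R} := HB.pack L Lm.
have cL : continuous L.
  have c i : continuous (fun v : E => pderiv i F x * v 0 i).
    move=> y; apply: (@continuousM R E (cst (pderiv i F x)) (fun v : E => v 0 i)).
      exact: (@cst_continuous E R).
    exact: coord_continuous.
  rewrite (_ : L = fun v => pderiv 0 F x * v 0 0 + pderiv 1 F x * v 0 1
                            + pderiv 2 F x * v 0 2); last by apply/funext => v; exact: sum3E.
  by move=> y; apply: continuousD (c 2 y); exact: continuousD (c 0 y) (c 1 y).
have FL : F \o shift x = cst (F x) + lL +o_ (0 : E) id.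
  apply/eqaddoP => e e0; have := C1_estimate e0 dF cF.
  apply: filterS => k h.
  suff -> : (F \o shift x - (cst (F x) + lL)) k = F (x + k) - F x - L k by [].
  by rewrite -[LHS]/(F (k + x) - (F x + L k)) opprD addrA (addrC k).
have dL := @diff_unique _ _ _ F lL x cL FL.
have df : differentiable F x.
  apply/diff_locallyxP; rewrite dL; split => // h.
  have := FL; rewrite funeqE => /(_ h) /= ->; rewrite !fctE /=; congr (_ + _).
split=> // v; by rewrite deriveE// dL.
Qed.

End PartialDerivatives.

(** * Chain rule and symmetry of second derivatives *)

Section ChainRule.
Variable R : realType.
Local Notation E := 'rV[R]_3.
Implicit Types (F G : E -> R) (f : E -> E) (x y z : E) (i j : 'I_3) (n : nat).

Lemma rV_continuous (T : topologicalType) (f : T -> E) (x : T) :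
  (forall i, {for x, continuous (fun t => f t 0 i)}) ->
  {for x, continuous f}.
Proof.
move=> cf; apply/(@cvgrPdist_le _ _ _ (nbhs x)) => e e0.
have : \forall y \near x, forall i, `|f x 0 i - f y 0 i| <= e.
  apply: (@filter_forall _ _ _ (nbhs x)) => i.
  by have /cvgrPdist_le/(_ e) := cf i; apply.
apply: filterS => y h; apply: normr_rV_le; first exact: ltW.
by move=> i; rewrite !mxE; exact: h.
Qed.

(** On the line through [x] in direction [v] the map [f] becomes a curve differentiable at [0], and
    this curve is composed with the differentiable [G]. *)
Lemma chain_rule G f x (v : E) : differentiable G (f x) ->
  (forall i, derivable (fun z => f z 0 i) x v) ->
  is_derive x v (G \o f) ('D_(\row_i 'D_v (fun z => f z 0 i) x) G (f x)).
Proof.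
move=> dG df.
have dfx : derivable f x v by apply/derivable_mxP => a i; rewrite ord1.
have x0 : x + 0 *: v = x by rewrite scale0r addr0.
have [lf lfE] := derivable_lineE f x v 0; rewrite x0 in lf lfE.
have [lG lGE] := derivable_lineE (G \o f) x v 0; rewrite x0 in lG lGE.
have dg : differentiable (fun h : R => f (x + h *: v)) 0.
  by apply/derivable1_diffP/lf.
have dG' : differentiable G ((fun h : R => f (x + h *: v)) 0) by rewrite /= x0.
have dc := differentiable_comp dg dG'.
apply: DeriveDef; first by apply: (lG.1 ((derivable1_diffP _ _).2 dc)).
have -> : \row_i 'D_v (fun z => f z 0 i) x = 'D_v f x.
  by rewrite (derive_mx dfx); apply/rowP => i; rewrite !mxE.
rewrite -lGE [LHS](deriveE _ dc) (diff_comp dg dG') /=.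
by rewrite -(deriveE _ dg) lfE x0 (deriveE _ dG).
Qed.

Lemma Cn1_differentiable G x : Cn 1 G x -> \forall y \near x, differentiable G y /\
  forall v : E, 'D_v G y = \sum_i pderiv i G y * v 0 i.
Proof.
move=> [cG [/near_join dG pG]].
have : \forall y \near x, forall i, {for y, continuous (pderiv i G)}.
  by apply: (@filter_forall _ _ _ (nbhs x)) => i; case: (pG i).
by apply: filterS2 dG => y; exact: C1_differentiable.
Qed.

Lemma Cn_le n m F x : (m <= n)%N -> Cn n F x -> Cn m F x.
Proof. by elim: n => [|n IH]; [case: m|rewrite leq_eqVlt => /orP[/eqP-> //|/IH h /CnW/h]]. Qed.

(** Induction on the order: a partial derivative of [G \o f] is a sum of products of some
    [pderiv i G \o f], of lower order, with a partial derivative of a component of [f]. *)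
Lemma Cn_comp n G f x : Cn n G (f x) -> (forall i, Cn n (fun y => f y 0 i) x) ->
  Cn n (G \o f) x.
Proof.
have cfx m (g : E -> E) : (forall i, Cn m (fun y => g y 0 i) x) ->
    \forall y \near x, {for y, continuous g}.
  move=> h; have : \forall y \near x, forall i, {for y, continuous (fun y => g y 0 i)}.
    by apply: (@filter_forall _ _ _ (nbhs x)) => i; exact: Cn_continuous (h i).
  by apply: filterS => y; exact: rV_continuous.
have cc m H : Cn m H (f x) -> (forall i, Cn m (fun y => f y 0 i) x) ->
    \forall y \near x, {for y, continuous (H \o f)}.
  move=> /Cn_continuous cH /cfx cf.
  apply: filterS2 cf (nbhs_singleton cf _ cH) => y; exact: continuous_comp.
elim: n G => [|n IH] G cG cf; split; try exact: cc cG cf.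
  by [].
have fx := nbhs_singleton (cfx _ _ cf).
have dG : \forall y \near x, differentiable G (f y) /\
    forall v : E, 'D_v G (f y) = \sum_i pderiv i G (f y) * v 0 i.
  exact: fx _ (Cn1_differentiable (@Cn_le n.+1 1 _ _ isT cG)).
have df : \forall y \near x, forall i j, derivable (fun z => f z 0 i) y (delta_mx 0 j).
  apply: (@filter_forall _ _ (fun i y => forall j,
    derivable (fun z => f z 0 i) y (delta_mx 0 j)) (nbhs x)) => i.
  by case: (cf i) => _ [].
have D : \forall y \near x, forall j, is_derive y (delta_mx 0 j : E) (G \o f)
    (pderiv 0 G (f y) * pderiv j (fun z => f z 0 0) y
     + pderiv 1 G (f y) * pderiv j (fun z => f z 0 1) y
     + pderiv 2 G (f y) * pderiv j (fun z => f z 0 2) y).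
  apply: filterS2 dG df => y [dG DG] df j.
  have := chain_rule dG (df ^~ j).
  by rewrite DG sum3E !mxE.
split; first by apply: filterS D => y D j; exact: (ex_derive (is_derive := D j)).
move=> j.
have part i : Cn n (fun y => pderiv i G (f y) * pderiv j (fun z => f z 0 i) y) x.
  apply: CnM; last by case: (cf i) => _ [_]; exact.
  apply: (IH (pderiv i G)); last by move=> k; exact/CnW/cf.
  by case: cG => _ [_]; exact.
apply: Cn_near (CnD (CnD (part 0) (part 1)) (part 2)).
by apply: filterS D => y /(_ j) D /=; rewrite /pderiv (derive_val (is_derive := D)).
Qed.

Lemma pderiv_shift F (c : E) y (v : E) :
  (derivable F (y + c) v -> derivable (fun z => F (z + c)) y v) /\
  'D_v (fun z => F (z + c)) y = 'D_v F (y + c).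
Proof.
rewrite /derivable /derive; set g1 := fun h => h^-1 *: _; set g2 := fun h => h^-1 *: _.
suff -> : g1 = g2 by [].
by rewrite funeqE /g1 /g2 => h /=; rewrite addrA.
Qed.

(** The second difference is the difference along [i] of [phi y = F (y + s e_j) - F y]. The mean
    value theorem along [i] turns it into a difference of [pderiv i F] along [j], and a second use
    into a mixed derivative. Two axis steps of length at most [r] explain the radius [r + r]. *)
Lemma second_difference F x i j (r s : R) : 0 < r -> `|s| <= r ->
  (forall y, `|y - x| <= r + r -> derivable F y (delta_mx 0 i) /\
    derivable (pderiv i F) y (delta_mx 0 j)) ->
  exists2 y, `|y - x| <= r + r &
    F (x + s *: delta_mx 0 i + s *: delta_mx 0 j) - F (x + s *: delta_mx 0 i)
    - F (x + s *: delta_mx 0 j) + F x = pderiv j (pderiv i F) y * s * s.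
Proof.
move=> r0 sr dF.
have ball2 (a b : R) : `|a| <= `|s| -> `|b| <= `|s| ->
    `|x + a *: delta_mx 0 i + b *: delta_mx 0 j - x| <= r + r.
  move=> a1 b1; rewrite (_ : _ - x = a *: delta_mx 0 i + b *: delta_mx 0 j); last first.
    by rewrite -(addrA x) addrAC subrr add0r.
  apply: le_trans (ler_normD _ _) _; rewrite !normrZ !norm_delta !mulr1.
  by rewrite lerD// (le_trans _ sr).
have ball1 (a : R) : `|a| <= `|s| -> `|x + a *: delta_mx 0 i - x| <= r + r.
  by move=> h; have := ball2 a 0 h; rewrite scale0r addr0; apply; rewrite normr0.
set ei := delta_mx 0 i : E; set ej := delta_mx 0 j : E.
pose phi y := F (y + s *: ej) - F y.
have dphi (t : R) : `|t| <= `|s| -> is_derive (x + t *: ei) ei phi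
    (pderiv i F (x + t *: ei + s *: ej) - pderiv i F (x + t *: ei)).
  move=> ts; have [h1 h2] := pderiv_shift F (s *: ej) (x + t *: ei) ei.
  have [h3 _] := dF _ (ball2 t s ts (lexx _)).
  have [h4 _] := dF _ (ball1 t ts).
  have D1 : is_derive (x + t *: ei) ei (fun z => F (z + s *: ej))
      (pderiv i F (x + t *: ei + s *: ej)).
    by apply: DeriveDef; [exact: h1 h3 | exact: h2].
  have D2 := derivableP h4.
  exact: (@is_deriveB _ _ _ _ _ _ _ _ _ D1 D2).
have [t ts E1] := @partial_MVT R phi x i s
  (fun t h => ex_derive (is_derive := dphi t h)).
rewrite /pderiv (derive_val (is_derive := dphi t ts)) in E1.
have [u us E2] := @partial_MVT R (pderiv i F) (x + t *: ei) j s
  (fun u h => (dF _ (ball2 t u ts h)).2).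
exists (x + t *: ei + u *: ej); first exact: ball2.
rewrite -E2 -E1 /phi opprB addrA addrAC (addrAC (F _)) //.
Qed.

(** The second difference is symmetric in [i] and [j], so the two mixed derivatives take the same
    value at points [y1] and [y2] close to [x]; continuity brings them together at [x]. *)
Lemma pderivC F x i j : Cn 2 F x -> pderiv i (pderiv j F) x = pderiv j (pderiv i F) x.
Proof.
move=> [_ [dF pF]].
have ddF k : \forall y \near x, forall l, derivable (pderiv k F) y (delta_mx 0 l).
  by case: (pF k) => _ [].
have cF k l : {for x, continuous (pderiv k (pderiv l F))}.
  by case: (pF l) => _ [_ /(_ k)] [] /nbhs_singleton.
apply/eqP; rewrite -subr_eq0 -normr_le0; apply/ler_addgt0Pl => e e0; rewrite addr0.
have key (a b c d : R) : `|a - c| <= e / 2 -> `|b - d| <= e / 2 -> c = d -> `|a - b| <= e.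
  move=> h1 h2 cd; rewrite (splitr e) -(subrKA c) (le_trans (ler_normD _ _))// lerD//.
  by rewrite distrC cd.
have e20 : 0 < e / 2 by rewrite divr_gt0.
have nearE k l : \forall y \near x,
    `|pderiv k (pderiv l F) x - pderiv k (pderiv l F) y| <= e / 2.
  by have /cvgrPdist_le/(_ (e / 2)) := cF k l; exact.
have : \forall y \near x, [/\ (forall l, derivable F y (delta_mx 0 l)),
   (forall l, derivable (pderiv i F) y (delta_mx 0 l)),
   (forall l, derivable (pderiv j F) y (delta_mx 0 l)),
   `|pderiv i (pderiv j F) x - pderiv i (pderiv j F) y| <= e / 2 &
   `|pderiv j (pderiv i F) x - pderiv j (pderiv i F) y| <= e / 2].
  have h1 := @filterI E (nbhs x) (nbhs_filter x) _ _ (ddF i) (ddF j).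
  have h2 := @filterI E (nbhs x) (nbhs_filter x) _ _ (nearE i j) (nearE j i).
  apply: (@filterS3 _ (nbhs x) _ _ _ _ _ _ dF h1 h2) => y a1 [a2 a3] [a4 a5].
  exact: And5 a1 a2 a3 a4 a5.
move=> /(nbhs_ballP x)[d /= d0 xd].
(* Any positive radius with [r + r < d] would do. *)
pose r := d / 3.
have r0 : 0 < r by rewrite divr_gt0.
have ballr y : `|y - x| <= r + r -> ball x d y.
  move=> h; rewrite -ball_normE /= distrC (le_lt_trans h)// /r; lra.
have rr : `|r| <= r by rewrite ger0_norm// ltW.
have [|y1 /ballr/xd[_ _ _ _ b1] E1] := @second_difference F x i j r r r0 rr.
  by move=> y /ballr/xd[].
have [|y2 /ballr/xd[_ _ _ b2 _] E2] := @second_difference F x j i r r r0 rr.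
  by move=> y /ballr/xd[].
have E12 : pderiv j (pderiv i F) y1 = pderiv i (pderiv j F) y2.
  apply: (mulIf (lt0r_neq0 r0)).
  apply: (mulIf (lt0r_neq0 r0)).
  apply: etrans (esym E1) (etrans _ E2).
  by rewrite (addrAC x) -!addrA; congr (_ + _); rewrite addrCA.
exact: (key _ _ _ _ b2 b1 (esym E12)).
Qed.

End ChainRule.

(** * Bump functions *)

Section Bump.
Variable R : realType.
Local Notation E := 'rV[R]_3.
Implicit Types (g : E -> R) (s : R) (x y z : E) (i j : 'I_3) (n k : nat).

(** The flat function [s^-k exp(-1/s)], continued by [0]. The powers are carried along because
    differentiation leads from index [k] to [k + 1] and [k + 2]; the bump function has [k = 0]. *)
Definition expinv k s : R := if 0 < s then s^-1 ^+ k * expR (- s^-1) else 0.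

Lemma expinv_gt0 k s : (0 < expinv k s) = (0 < s).
Proof.
rewrite /expinv; case: ifP => [s0|]; last by rewrite ltxx.
by rewrite mulr_gt0 ?expR_gt0 ?exprn_gt0 ?invr_gt0.
Qed.

Lemma expinv_ge0 k s : 0 <= expinv k s.
Proof.
have [s0|s0] := ltP 0 s; first by rewrite ltW ?expinv_gt0.
by rewrite /expinv ltNge s0.
Qed.

Lemma expinv_eq0 k s : s <= 0 -> expinv k s = 0.
Proof. by rewrite /expinv leNgt => /negbTE ->. Qed.

(** With [y = 1/s], the exponential series gives [y^(k+1) <= (k+1)! exp y]. This linear bound, used
    at the next index, makes the derivative at [0] vanish. *)
Lemma expinv_le k s : 0 <= s -> expinv k s <= k.+1`!%:R * s.
Proof.
rewrite /expinv; case: ifP => [s0 _|_ s0]; last by rewrite mulr_ge0.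
have y0 : 0 < s^-1 by rewrite invr_gt0.
have := expR_ge1Dxn k (ltW y0).
set y := s^-1 in y0 *; rewrite expRN => h.
have f0 : 0 < k.+1`!%:R :> R by rewrite ltr0n fact_gt0.
have {}h : y ^+ k.+1 <= k.+1`!%:R * expR y.
  rewrite mulrC -ler_pdivrMr//; apply: le_trans h; lra.
rewrite ler_pdivrMr ?expR_gt0//.
have -> : s = y^-1 by rewrite invrK.
by rewrite mulrAC ler_pdivlMr// -exprSr.
Qed.

Lemma is_derive_expinv k s :
  is_derive s 1 (expinv k) (expinv k.+2 s - k%:R * expinv k.+1 s).
Proof.
have [s0|s0|->] := ltgtP s 0.
- rewrite !expinv_eq0 ?ltW// mulr0 subr0.
  apply: near_eq_is_derive (@is_derive_cst R R R 0 s 1).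
  near=> u; rewrite expinv_eq0//= ltW//; near: u; exact: lt_nbhsl.
- have E1 : {near s, (fun u => u^-1 ^+ k * expR (- u^-1)) =1 expinv k}.
    near=> u; rewrite /expinv ifT//; near: u; exact: lt_nbhsr.
  apply: near_eq_is_derive E1 _.
  rewrite /expinv s0.
  have sn0 : s != 0 by rewrite gt_eqF.
  have DV : is_derive s (1 : R) (fun u : R => u^-1) (- s ^- 2).
    by have := @is_deriveV _ id s 1 1 sn0 (is_derive_id _ _); rewrite scaler1.
  have Dk := @is_deriveX _ _ (fun u : R => u^-1) k s 1 _ DV.
  have DN := @is_deriveN _ _ _ (fun u : R => u^-1) s 1 _ DV.
  have De := @is_derive1_comp _ _ (fun u : R => - u^-1) s _ _ (is_derive_expR _) DN.
  have D := @is_deriveM _ _ _ _ s 1 _ _ Dk De.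
  rewrite exprfctE /= in D.
  apply: (@is_derive_eq _ _ _ _ _ _ _ _ D) => /=.
  rewrite exprVn /GRing.scale /=.
  case: k {Dk D} => [|k] /=; rewrite !exprVn.
    by field.
  by rewrite -!exprVn !exprS expr0; set y := s^-1; set m := k.+1%:R; ring.
- rewrite !expinv_eq0// mulr0 subr0.
  have D : h^-1 *: (expinv k (h *: 1 + 0) - expinv k 0) @[h --> (0:R)^'] --> (0 : R).
    apply/cvgrPdist_le => e e0; near=> h.
    rewrite sub0r normrN addr0 [h *: 1]mulr1 (expinv_eq0 _ (lexx 0)) subr0.
    rewrite normrM normfV (ger0_norm (expinv_ge0 _ _)).
    have [h0|h0] := leP h 0; first by rewrite expinv_eq0// mulr0 ltW.
    (* Dividing by [h] raises the index by one, and [expinv k.+1 h] is at most a constant times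
       [h]. *)
    apply: (@le_trans _ _ (expinv k.+1 h)).
      by rewrite gtr0_norm// /expinv h0 exprS mulrA.
    apply: le_trans (expinv_le _ (ltW h0)) _.
    rewrite -(ger0_norm (ltW h0)) mulrC -ler_pdivlMr ?ltr0n ?fact_gt0//.
    near: h; apply: dnbhs0_le; by rewrite divr_gt0// ltr0n fact_gt0.
  by apply: DeriveDef; [apply/cvg_ex; exists 0 | apply/cvg_lim].
Unshelve. all: by end_near. Qed.

Lemma expinv_continuous k : continuous (expinv k).
Proof.
move=> s; apply: differentiable_continuous; apply/derivable1_diffP.
exact: (ex_derive (is_derive := is_derive_expinv k s)).
Qed.

Lemma Cn_expinv n k g x : Cn n g x -> Cn n (expinv k \o g) x.
Proof.
elim: n k g => [|n IH] k g.
  move=> [cg _]; split=> //; apply: filterS cg => y cg.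
  by apply: continuous_comp => //; exact: expinv_continuous.
move=> g1; have gn := CnW g1; case: g1 => cg [dg pg].
have D : \forall y \near x, forall i, is_derive y (delta_mx 0 i : E) (expinv k \o g)
    ((expinv k.+2 (g y) - k%:R * expinv k.+1 (g y)) * pderiv i g y).
  apply: filterS dg => y dg i; set e := delta_mx 0 i : E.
  have y0 : y + 0 *: e = y by rewrite scale0r addr0.
  have [l1 l2] := derivable_lineE (expinv k \o g) y e 0; rewrite y0 in l1 l2.
  have dg0 : derivable g (y + 0 *: e) e by rewrite y0; exact: dg.
  have Dg := is_derive_line dg0; rewrite y0 in Dg.
  have De := is_derive_expinv k (g (y + 0 *: e)).
  have := @is_derive1_comp _ _ (fun h : R => g (y + h *: e)) _ _ _ De Dg.
  rewrite y0 => Dc.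
  apply: DeriveDef; first by apply: l1.1; exact: (ex_derive (is_derive := Dc)).
  by rewrite -l2 (derive_val (is_derive := Dc)).
split.
  by apply: filterS cg => y cg; apply: continuous_comp => //; exact: expinv_continuous.
split; first by apply: filterS D => y D i; exact: (ex_derive (is_derive := D i)).
move=> i.
have h : Cn n (fun y => (expinv k.+2 (g y) + - k%:R * expinv k.+1 (g y)) * pderiv i g y) x.
  apply: CnM (pg i); apply: CnD (IH _ _ gn) _.
  exact: CnM (Cn_cst _ _ _) (IH _ _ gn).
apply: Cn_near h; apply: filterS D => y /(_ i) D /=.
by rewrite /pderiv (derive_val (is_derive := D)) mulNr.
Qed.

End Bump.

(** * Hadamard's lemma *)

Section Hadamard.
Variable R : realType.
Local Notation E := 'rV[R]_3.
Local Notation mu := (@lebesgue_measure R).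
Implicit Types (F H : E -> R) (s : R) (x y z : E) (i j : 'I_3) (n k : nat).

(** Contraction of the coordinate [t] alone: as [s] runs from [0] to [1], the projection of [y] to
    the plane [t = 0] is joined to [y]. *)
Definition shrink s y : E := \row_i (if i == 0 then s * y 0 0 else y 0 i).

Definition shrink_integral k H y : R :=
  \int[mu]_(s in `[0, 1]) (s ^+ k * H (shrink s y)).

Variables (x0 : E) (r : R).
Hypothesis x00 : x0 0 0 = 0.

Let D (rho : R) : set E := [set y | `|y - x0| <= rho].

(** The centre lies on the plane [t = 0] by [x00], so scaling [t] moves no point farther from it in
    the maximum norm. *)
Lemma shrink_ball rho s y : 0 <= s <= 1 -> D rho y -> D rho (shrink s y).
Proof.
move=> /andP[s0 s1]; rewrite /D /= => h; apply: (le_trans _ h).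
apply: normr_rV_le => // i; rewrite !mxE; case: eqP => [->|_]; last first.
  by have := normr_coord (y - x0) i; rewrite !mxE.
have := normr_coord (y - x0) 0; rewrite !mxE x00 !subr0 normrM ger0_norm//.
by apply: le_trans; rewrite ler_piMl.
Qed.

Lemma shrink_continuous y : continuous (shrink ^~ y).
Proof.
move=> s; apply: rV_continuous => i.
rewrite (_ : (fun t => _) = fun t => if i == 0 then t * y 0 0 else y 0 i); last first.
  by apply/funext => t; rewrite mxE.
case: eqP => _; last exact: (@cst_continuous R R).
by apply: (@continuousM R R id (cst (y 0 0))) => //; exact: (@cst_continuous R R).
Qed.

Lemma compact_ball rho : compact (D rho).
Proof.
apply: bounded_closed_compact.
  exists (rho + `|x0|); split; first exact: num_real.
  move=> m lm y Dy; apply: (le_trans _ (ltW lm)).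
  by rewrite -(subrK x0 y) (le_trans (ler_normD _ _))// lerD2r.
have -> : D rho = (fun y => `|y - x0|) @^-1` [set u | u <= rho] by [].
apply: closed_comp => [y _|]; last exact: closed_le.
apply: (@continuous_comp E E R (fun y => y - x0) (fun y => `|y|)).
  apply: (@continuousB R E E id (cst x0)) => //; exact: (@cst_continuous E E).
exact: norm_continuous.
Qed.

Lemma bounded_ball F rho : 0 <= rho -> (forall y, D rho y -> {for y, continuous F}) ->
  exists m : R, forall y, D rho y -> `|F y| <= m.
Proof.
move=> rho0 cF.
have [||c _ cmax] := @EVT_max_rV R 3 (fun y => `|F y|) _ _ (@compact_ball rho).
- by exists x0; rewrite /D /= subrr normr0.
- apply: continuous_in_subspaceT => y /set_mem Dy.
  apply: continuous_comp; [exact: cF|exact: norm_continuous].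
- by exists `|F c| => y /mem_set; exact: cmax.
Qed.

Lemma integrable_shrink k F y rho : D rho y ->
  (forall z, D rho z -> {for z, continuous F}) ->
  mu.-integrable `[0, 1] (EFin \o (fun s => s ^+ k * F (shrink s y))).
Proof.
move=> Dy cF; apply: continuous_compact_integrable; first exact: segment_compact.
apply: continuous_in_subspaceT => s /set_mem /=; rewrite in_itv /= => s01.
apply: (@continuousM R R (fun s => s ^+ k) (fun s => F (shrink s y))).
  exact: exprn_continuous.
apply: (@continuous_comp R E R (shrink ^~ y) F); first exact: shrink_continuous.
by apply: cF; exact: shrink_ball.
Qed.

Lemma is_derive_shrink F s z i : Cn 1 F (shrink s z) ->
  is_derive z (delta_mx 0 i : E) (F \o shrink s)
    ((if i == 0 then s else 1) * pderiv i F (shrink s z)).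
Proof.
move=> cF; have [dF DF] := nbhs_singleton (Cn1_differentiable cF).
have Dj j : is_derive z (delta_mx 0 i : E) (fun y => shrink s y 0 j)
    ((j == i)%:R * (if i == 0 then s else 1)).
  rewrite (_ : (fun y => _) = fun y : E => if j == 0 then s * y 0 0 else y 0 j); last first.
    by apply/funext => y; rewrite mxE.
  have Dj := is_derive_coord z (delta_mx 0 i) j; rewrite mxE eqxx /= in Dj.
  have [j0|j0] := eqVneq j 0; last first.
    by apply: (is_derive_eq Dj); case: eqVneq => [<-|_]; rewrite ?mul0r// (negbTE j0) mulr1.
  subst j.
  have := @is_deriveZ R E R (fun y => y 0 0) s z _ _ Dj.
  move=> /is_derive_eq; apply; rewrite eq_sym /GRing.scale /=.
  by case: eqP => _; rewrite ?mul0r ?mul1r ?mulr1 ?mulr0.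
have := @chain_rule R F (shrink s) z (delta_mx 0 i) dF (fun j => ex_derive (is_derive := Dj j)).
rewrite DF => /is_derive_eq; apply.
rewrite (bigD1 i)//= big1 => [|j ji].
  by rewrite addr0 mxE (derive_val (is_derive := Dj i)) eqxx mul1r mulrC.
by rewrite mxE (derive_val (is_derive := Dj j)) (negbTE ji) mul0r mulr0.
Qed.

Lemma smooth_pderiv_ball H i :
  (forall z, `|z - x0| < r -> smooth_at H z) ->
  forall z, `|z - x0| < r -> smooth_at (pderiv i H) z.
Proof. by move=> sH z zr; exact/smooth_at_pderiv/sH. Qed.

(* [shrink_integral] is closed under partial derivatives, which is why the powers
   [s ^+ k] are carried along. *)
Lemma is_derive_shrink_integral k H y i : `|y - x0| < r ->
  (forall z, `|z - x0| < r -> smooth_at H z) ->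
  is_derive y (delta_mx 0 i : E) (shrink_integral k H)
    (shrink_integral (k + (i == 0%R)) (pderiv i H) y).
Proof.
move=> yr sH; set e := delta_mx 0 i : E.
(* [rho] lies strictly between [|y - x0|] and [r]: the closed ball of radius [rho] is compact, lies
   where [H] is smooth, and contains [y + h e] for [|h| < d]. The bound [m] of the partial
   derivative on it serves as dominating function. *)
pose rho := (`|y - x0| + r) / 2; pose d := rho - `|y - x0|.
have d0 : 0 < d by rewrite /d /rho; lra.
have Dr z : D rho z -> `|z - x0| < r.
  by rewrite /D /= => h; apply: (le_lt_trans h); rewrite /rho; lra.
have rho0 : 0 <= rho by rewrite /rho divr_ge0// addr_ge0// ltW// (le_lt_trans _ yr).
have ye (h : R) : `]- d, d[%classic h -> D rho (y + h *: e).
  rewrite /= in_itv /= -ltr_norml /D /= => hd.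
  rewrite addrAC (le_trans (ler_normD _ _))// normrZ norm_delta mulr1.
  by rewrite -lerBrDl ltW.
have I0 : `]- d, d[%classic (0 : R) by rewrite /= in_itv /= oppr_lt0 d0.
have Hc z : D rho z -> {for z, continuous H} by move=> /Dr/sH/smooth_at_continuous.
have pHc z : D rho z -> {for z, continuous (pderiv i H)}.
  by move=> /Dr/sH/(@smooth_at_pderiv _ _ _ i)/smooth_at_continuous.
have [m mb] := bounded_ball rho0 pHc.
have m0 : 0 <= m by apply: le_trans (mb x0 _); rewrite // /D /= subrr normr0.
pose f (h s : R) := s ^+ k * H (shrink s (y + h *: e)).
have df (h s : R) : `]- d, d[%classic h -> `[0, 1]%classic s ->
    is_derive h 1 (f ^~ s)
      (s ^+ k * ((if i == 0 then s else 1) * pderiv i H (shrink s (y + h *: e)))).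
  move=> hI; rewrite /= in_itv /= => s01.
  have sHs := sH _ (Dr _ (shrink_ball s01 (ye h hI))).
  have Ds := is_derive_shrink i (sHs 1%N).
  have := is_derive_line (ex_derive (is_derive := Ds)).
  rewrite (derive_val (is_derive := Ds)) => Dl.
  exact: (@is_deriveZ R R R (fun h : R => H (shrink s (y + h *: e))) (s ^+ k) h 1 _ Dl).
have mI : measurable (`[0, 1]%classic : set R) by exact: measurable_itv.
have intf (h : R) : `]- d, d[%classic h -> mu.-integrable `[0, 1] (EFin \o f h).
  by move=> hI; exact: integrable_shrink (ye _ hI) Hc.
have derf (h s : R) : `]- d, d[%classic h -> `[0, 1]%classic s -> derivable (f ^~ s) h 1.
  by move=> hI sI; exact: (ex_derive (is_derive := df h s hI sI)).
have intG : mu.-integrable `[0, 1] (EFin \o (cst m : R -> R)).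
  apply: continuous_compact_integrable; first exact: segment_compact.
  by apply: continuous_subspaceT; exact: (@cst_continuous R R).
have Gub (h s : R) : `]- d, d[%classic h -> `[0, 1]%classic s ->
    `|partial1of2 f h s| <= cst m s.
  move=> hI sI; rewrite partial1of2E (derive_val (is_derive := df h s hI sI)) /=.
  move: sI; rewrite /= in_itv /= => s01; move: (s01) => /andP[s0 s1].
  rewrite normrM -[leRHS]mul1r ler_pM//.
    by rewrite normrX exprn_ile1// ger0_norm.
  rewrite normrM -[leRHS]mul1r ler_pM//.
    by case: ifP => _; rewrite ?normr1// ger0_norm.
  by apply: mb; apply: shrink_ball => //; exact: ye.
have h1 := @derivable_under_integral R _ _ mu f `[0, 1] mI 0 (- d) d I0 intf derf (cst m)
  (fun=> m0) intG Gub.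
have h2 := @differentiation_under_integral R _ _ mu f `[0, 1] mI 0 (- d) d I0 intf derf (cst m)
  (fun=> m0) intG Gub.
have [l1 l2] := derivable_lineE (shrink_integral k H) y e 0.
have y0 : y + 0 *: e = y by rewrite scale0r addr0.
rewrite y0 in l1 l2.
apply: DeriveDef; first exact: l1.1.
rewrite -l2 -[LHS]derive1E; apply: etrans h2 _.
apply: eq_Rintegral => s /set_mem sI.
rewrite partial1of2E (derive_val (is_derive := df 0 s I0 sI)) y0.
by rewrite exprD mulrA; case: eqP => _; rewrite ?expr1 ?expr0.
Qed.

Lemma near_ball y : `|y - x0| < r -> \forall z \near y, `|z - x0| < r.
Proof.
move=> yr; apply/(nbhs_ballP y); exists (r - `|y - x0|); first by rewrite /= subr_gt0.
move=> z; rewrite -ball_normE /= ltrBrDr => h.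
by rewrite (le_lt_trans _ h)// -(subrKA y z) (distrC y) ler_normD.
Qed.

Lemma shrink_integral_le k F y rho (m : R) : D rho y ->
  (forall z, D rho z -> {for z, continuous F}) -> (forall z, D rho z -> `|F z| <= m) ->
  `|shrink_integral k F y| <= m.
Proof.
move=> Dy cF mF.
have intF := integrable_shrink k Dy cF.
have hle : `|shrink_integral k F y| <= \int[mu]_(s in `[0, 1]) `|s ^+ k * F (shrink s y)|.
  by apply: le_normr_Rintegral => //; exact: measurable_itv.
apply: le_trans hle _.
apply: (@le_trans _ _ (\int[mu]_(s in `[0, 1]) m)); last first.
  have mu1 : mu `[0, 1]%classic = 1%E.
    by rewrite lebesgue_measure_itv /= lte_fin ltr01 oppr0 adde0.
  rewrite Rintegral_cst; last exact: measurable_itv.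
  have h := congr1 (fun u => m * fine u) mu1; rewrite /= mulr1 in h.
  rewrite le_eqVlt; apply/orP; left; apply/eqP; exact: h.
apply: le_Rintegral => //.
- exact: (integrable_norm intF).
- apply: continuous_compact_integrable; first exact: segment_compact.
  by apply: continuous_subspaceT; exact: (@cst_continuous R R).
- move=> s; rewrite /= in_itv /= => s01; rewrite normrM -[leRHS]mul1r ler_pM//.
    by case/andP: s01 => s0 s1; rewrite normrX exprn_ile1// ger0_norm.
  by apply: mF; exact: shrink_ball.
Qed.

(** The partial derivatives are again integrals of this kind, hence bounded near [y] by bounds of
    the [pderiv i H] on a compact ball; [bounded_pderiv_continuous] then applies. *)
Lemma shrink_integral_continuous k H y : `|y - x0| < r ->
  (forall z, `|z - x0| < r -> smooth_at H z) -> {for y, continuous (shrink_integral k H)}.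
Proof.
move=> yr sH.
pose rho := (`|y - x0| + r) / 2.
have Dr z : D rho z -> `|z - x0| < r.
  by rewrite /D /= => h; apply: (le_lt_trans h); rewrite /rho; lra.
have rho0 : 0 <= rho by rewrite /rho divr_ge0// addr_ge0// ltW// (le_lt_trans _ yr).
have pHc i z : D rho z -> {for z, continuous (pderiv i H)}.
  by move=> /Dr/sH/(@smooth_at_pderiv _ _ _ i)/smooth_at_continuous.
have [m0 mb0] := bounded_ball rho0 (pHc 0).
have [m1 mb1] := bounded_ball rho0 (pHc 1).
have [m2 mb2] := bounded_ball rho0 (pHc 2).
apply: (@bounded_pderiv_continuous _ _ _ (Num.max (Num.max m0 m1) m2)).
have : \forall z \near y, D rho z.
  apply/(nbhs_ballP y); exists (rho - `|y - x0|); first by rewrite /= subr_gt0 /rho; lra.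
  move=> z; rewrite -ball_normE /= ltrBrDr /D /= => h.
  by rewrite (le_trans _ (ltW h))// -(subrKA y z) (distrC y) ler_normD.
apply: filterS => z Dz i; have ID := is_derive_shrink_integral k i (Dr _ Dz) sH.
split; first exact: (ex_derive (is_derive := ID)).
rewrite /pderiv (derive_val (is_derive := ID)).
apply: (shrink_integral_le _ Dz (pHc i)).
move: i {ID}; apply: ord3P => w Dw.
- by have h := mb0 w Dw; rewrite !le_max h.
- by have h := mb1 w Dw; rewrite !le_max h orbT.
- by have h := mb2 w Dw; rewrite !le_max h !orbT.
Qed.

Lemma Cn_shrink_integral n k H y : `|y - x0| < r ->
  (forall z, `|z - x0| < r -> smooth_at H z) -> Cn n (shrink_integral k H) y.
Proof.
move=> /near_ball yn sH.
elim: n k H sH => [|n IH] k H sH.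
  by split=> //; apply: filterS yn => z zr; exact: shrink_integral_continuous.
split; first by apply: filterS yn => z zr; exact: shrink_integral_continuous.
split.
  apply: filterS yn => z zr i.
  exact: (ex_derive (is_derive := is_derive_shrink_integral k i zr sH)).
move=> i; apply: Cn_near (IH (k + (i == 0%R))%N _ (@smooth_pderiv_ball H i sH)).
apply: filterS yn => z zr /=.
by rewrite -(derive_val (is_derive := is_derive_shrink_integral k i zr sH)).
Qed.

(** Fundamental theorem of calculus for [s |-> F (shrink s y)] on the unit interval, whose
    derivative is [y 0 0] times the [t]-derivative of [F]. *)
Lemma shrink_FTC F y : `|y - x0| < r ->
  (forall z, `|z - x0| < r -> smooth_at F z) ->
  F y - F (shrink 0 y) = y 0 0 * shrink_integral 0 (pderiv 0 F) y.
Proof.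
move=> yr sF.
pose v : E := y 0 0 *: delta_mx 0 0.
have lineE s : shrink s y = shrink 0 y + s *: v.
  apply/rowP => i; rewrite !mxE eqxx /=; case: (i == 0); rewrite ?mul0r ?add0r ?mulr1//.
  by rewrite !mulr0 addr0.
have Dy : D `|y - x0| y by rewrite /D /=.
have Dr z : D `|y - x0| z -> `|z - x0| < r by move=> h; exact: le_lt_trans yr.
pose f s := y 0 0 * pderiv 0 F (shrink s y).
have dF s : 0 <= s <= 1 -> is_derive s 1 (fun h : R => F (shrink h y)) (f s).
  move=> s01; have sFs := sF _ (Dr _ (shrink_ball s01 Dy)).
  have [dF DF] := nbhs_singleton (Cn1_differentiable (sFs 1%N)).
  have dv : derivable F (shrink 0 y + s *: v) v by rewrite -(lineE s); exact: diff_derivable.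
  have := is_derive_line dv.
  rewrite (_ : (fun h : R => F (shrink 0 y + h *: v)) = fun h : R => F (shrink h y)); last first.
    by apply/funext => h; rewrite (lineE h).
  rewrite -(lineE s) DF sum3E !mxE /= !mulr1 !mulr0 !addr0 mulrC; exact.
have cF z : D `|y - x0| z -> {for z, continuous (pderiv 0 F)}.
  by move=> /Dr/sF/(@smooth_at_pderiv _ _ _ 0)/smooth_at_continuous.
have FC s : 0 <= s <= 1 -> {for s, continuous (fun h : R => F (shrink h y))}.
  move=> s01; apply: differentiable_continuous; apply/derivable1_diffP.
  exact: (ex_derive (is_derive := dF s s01)).
have cf : {within `[0, 1], continuous f}.
  apply: continuous_in_subspaceT => s /set_mem /=; rewrite in_itv /= => s01.
  apply: (@continuousM R R (cst (y 0 0)) (fun s => pderiv 0 F (shrink s y))).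
    exact: (@cst_continuous R R).
  apply: (@continuous_comp R E R (shrink ^~ y) (pderiv 0 F)); first exact: shrink_continuous.
  by apply: cF; exact: shrink_ball.
have LR : derivable_oo_LRcontinuous (fun h : R => F (shrink h y)) 0 1.
  split.
  - move=> s; rewrite in_itv /= => /andP[s0 s1].
    have s01 : 0 <= s <= 1 by rewrite !ltW.
    exact: (ex_derive (is_derive := dF s s01)).
  - by apply: cvg_at_right_filter; apply: FC; rewrite lexx ler01.
  - by apply: cvg_at_left_filter; apply: FC; rewrite lexx ler01.
have F'f : {in `]0, 1[, (fun h : R => F (shrink h y))^`()%classic =1 f}.
  move=> s; rewrite in_itv /= => /andP[s0 s1].
  have s01 : 0 <= s <= 1 by rewrite !ltW.
  by rewrite derive1E (derive_val (is_derive := dF s s01)).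
have := continuous_FTC2 ltr01 cf LR F'f.
rewrite (_ : shrink 1 y = y); last first.
  by apply/rowP => i; rewrite !mxE; case: eqP => [->|//]; rewrite mul1r.
rewrite /shrink_integral -RintegralZl//; last exact: integrable_shrink Dy cF.
rewrite /Rintegral => h.
under eq_integral do rewrite expr0 mul1r.
by rewrite h.
Qed.

End Hadamard.

Section HadamardLemma.
Variable R : realType.
Local Notation E := 'rV[R]_3.

(** The quotient is the mean of the [t]-derivative of [F] along the segment from the projection of
    [y] to [y]. This formula stays smooth on the plane [t = 0], where one cannot divide by [t]. *)
Lemma Hadamard (F : E -> R) (x : E) : x 0 0 = 0 -> smooth_near F x ->
  (\forall y \near x, (y : E) 0 0 = 0 -> F y = 0) ->
  exists2 G : E -> R, smooth_near G x & \forall y \near x, F y = (y : E) 0 0 * G y.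
Proof.
move=> x00 sF F0.
have /(nbhs_ballP x)[r /= r0 xr] := @filterI _ (nbhs x) (nbhs_filter x) _ _ sF F0.
have sF' z : `|z - x| < r -> smooth_at F z.
  by move=> h; case: (xr z) => //; rewrite -ball_normE /= distrC.
have xx : `|x - x| < r by rewrite subrr normr0.
exists (shrink_integral 0 (pderiv 0 F)).
  apply: filterS (near_ball xx) => y yr n.
  exact: (Cn_shrink_integral x00 n 0%N yr (@smooth_pderiv_ball R x r F 0 sF')).
apply: filterS (near_ball xx) => y yr.
rewrite -(shrink_FTC x00 yr sF').
have s01 : 0 <= (0 : R) <= 1 by rewrite lexx ler01.
case: (xr (shrink 0 y)) => [|_ ->]; last 2 first.
- by rewrite subr0.
- by rewrite mxE eqxx mul0r.
rewrite -ball_normE /= distrC (le_lt_trans _ yr)//.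
exact: (shrink_ball x00 s01 (lexx _)).
Qed.

End HadamardLemma.

(** * Calculus on a b-manifold *)

Lemma near_neq0 (R : realType) (T : topologicalType) (u : T -> R) (p : T) :
  {for p, continuous u} -> u p != 0 -> \forall q \near p, u q != 0.
Proof.
move=> cu up; apply: (cu [set r | r != 0]).
by apply: open_nbhs_nbhs; split => //; exact: open_neq.
Qed.

Section SmoothNear.
Variable R : realType.
Local Notation E := 'rV[R]_3.
Implicit Types (F G : E -> R) (x : E).

Lemma smooth_near_cst (a : R) x : smooth_near (cst a) x.
Proof. by apply: (@nearW _ (nbhs x)) => y n; exact: Cn_cst. Qed.

Lemma smooth_near_coord i x : smooth_near (fun y : E => y 0 i) x.
Proof. by apply: (@nearW _ (nbhs x)) => y n; exact: Cn_coord. Qed.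

Lemma smooth_nearD F G x : smooth_near F x -> smooth_near G x ->
  smooth_near (fun y => F y + G y) x.
Proof. by apply: filterS2 => y sF sG n; exact: CnD. Qed.

Lemma smooth_nearM F G x : smooth_near F x -> smooth_near G x ->
  smooth_near (fun y => F y * G y) x.
Proof. by apply: filterS2 => y sF sG n; exact: CnM. Qed.

Lemma smooth_nearV F x : F x != 0 -> smooth_near F x -> smooth_near (fun y => (F y)^-1) x.
Proof.
move=> Fx0 sF.
have F0 := near_neq0 (smooth_at_continuous (smooth_near_at sF)) Fx0.
by apply: filterS2 F0 sF => y F0 sF n; exact: CnV.
Qed.

Lemma smooth_near_expinv k F x : smooth_near F x -> smooth_near (expinv k \o F) x.
Proof. by apply: filterS => y sF n; exact: Cn_expinv. Qed.

Lemma smooth_near_comp F (f : E -> E) x : smooth_near F (f x) ->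
  (forall i, smooth_near (fun y => f y 0 i) x) -> smooth_near (F \o f) x.
Proof.
move=> sF sf.
have cf : {for x, continuous f}.
  by apply: rV_continuous => i; exact: smooth_at_continuous (smooth_near_at (sf i)).
have sf' : \forall y \near x, forall i, smooth_at (fun y => f y 0 i) y.
  by apply: (@filter_forall _ _ _ (nbhs x)) => i; exact: sf.
have sF' : \forall y \near x, smooth_at F (f y) by exact: cf _ sF.
by apply: filterS2 sF' sf' => y sF1 sf1 n; apply: Cn_comp => // i; exact: sf1.
Qed.

End SmoothNear.

Section Manifold.
Variables (R : realType) (M : bmanifold3 R).
Local Notation E := 'rV[R]_3.
Local Notation C := (chart M).
Implicit Types (c : C) (p q : M) (i j : 'I_3) (u v : M -> R).

Lemma phi_continuous c p : dom c p -> {for p, continuous (phi c)}.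
Proof.
move=> cp; have : {within dom c, continuous (phi c)} := @bm_phi_continuous R M c.
by rewrite continuous_open_subspace; [apply; exact/mem_set|exact: bm_dom_open].
Qed.

Lemma dom_near c p : dom c p -> \forall q \near p, dom c q.
Proof. by move=> cp; apply: open_nbhs_nbhs; split => //; exact: bm_dom_open. Qed.

Lemma phiK c p : dom c p -> psi c (phi c p) = p.
Proof. by move=> cp; apply: bm_phiK; exact/mem_set. Qed.

(** At a boundary point the image of a chart is not a neighbourhood in the model space, hence the
    restriction to values [y = phi c q]. *)
Lemma chart_near c p (P : set M) : dom c p -> (\forall q \near p, P q) ->
  \forall y \near phi c p, forall q, dom c q -> y = phi c q -> P q.
Proof.
move=> cp pP.
have h : {within phi c @` dom c, continuous (psi c)} := @bm_psi_continuous R M c.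
have im : (phi c @` dom c) (phi c p) by exists p.
have pP' : nbhs (psi c (phi c p)) P by rewrite phiK.
have {}h : nbhs (phi c p) (fun y => (phi c @` dom c) y -> P (psi c y)).
  exact: (subspace_continuousP _ _).1 h _ im P pP'.
by apply: filterS h => y h q cq yq; rewrite -(phiK cq) -yq; apply: h; exists q.
Qed.

(* At a boundary point only the [t]-axis leaves the chart, and there [e_0 = 0]. *)
Lemma image_near_line c p i : dom c p -> bweight c i p != 0 ->
  \forall h \near (0 : R), (phi c @` dom c) (phi c p + h *: delta_mx 0 i).
Proof.
move=> cp w0; have [U openU UE] := @bm_image _ M c.
have : (U `&` half_space (half c)) (phi c p) by rewrite -UE; exists p.
move=> [Ocp Hcp].
have lc : {for (0 : R), continuous (fun h : R => phi c p + h *: delta_mx 0 i : E)}.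
  apply: (@continuousD R E R (cst (phi c p)) (fun h : R => h *: delta_mx 0 i)).
    exact: (@cst_continuous R E).
  exact: scalel_continuous.
have lO : \forall h \near (0 : R), U (phi c p + h *: delta_mx 0 i).
  by apply: lc; rewrite scale0r addr0; apply: open_nbhs_nbhs.
have lH : \forall h \near (0 : R), half_space (half c) (phi c p + h *: delta_mx 0 i).
  move: w0; rewrite /bweight; have [->|i0 _] := eqVneq i ord0 => [w0|]; last first.
    apply: (@nearW _ (nbhs (0 : R))) => h b; rewrite !mxE eq_sym.
    by rewrite (negbTE i0) andbF mulr0 addr0; exact: Hcp.
  case b: (half c); last by apply: (@nearW _ (nbhs (0 : R))).
  have t0 : 0 < phi c p 0 0 by rewrite lt_def w0; exact: Hcp.
  have : \forall h \near (0 : R), - phi c p 0 0 < h by apply: lt_nbhsr; rewrite oppr_lt0.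
  apply: filterS => h hb _; rewrite !mxE !eqxx mulr1.
  by rewrite -lerBlDl sub0r ltW.
by rewrite UE; apply: filterS2 lO lH.
Qed.

(** Smoothness at a point through an extension [F] to a full neighbourhood in the model space, so
    that at a boundary point the derivatives of [F] can be used. *)
Definition bsmooth c p u := exists2 F : E -> R,
  smooth_near F (phi c p) & \forall q \near p, u q = F (phi c q).

(** If the weight is zero, both sides vanish. Otherwise the line through [phi c p] in direction [i]
    stays in the chart image for small parameters, and there [u \o psi c] and [F] coincide. So the
    choice of extension is immaterial. *)
Lemma bderiv_at c p i u (F : E -> R) : dom c p ->
  (\forall q \near p, u q = F (phi c q)) ->
  bderiv c i u p = bweight c i p * pderiv i F (phi c p).
Proof.
move=> cp uF; rewrite /bderiv.
have [->|w0] := eqVneq (bweight c i p) 0; first by rewrite !mul0r.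
congr (_ * _); rewrite /pderiv.
set e := delta_mx 0 i : E.
have x0 : phi c p + 0 *: e = phi c p by rewrite scale0r addr0.
have [_ E1] := derivable_lineE (u \o psi c) (phi c p) e 0.
have [_ E2] := derivable_lineE F (phi c p) e 0.
rewrite x0 in E1 E2; rewrite -E1 -E2.
have lc : {for (0 : R), continuous (fun h : R => phi c p + h *: e : E)}.
  apply: (@continuousD R E R (cst (phi c p)) (fun h : R => h *: e)).
    exact: (@cst_continuous R E).
  exact: scalel_continuous.
have ch : \forall h \near (0 : R), forall q, dom c q -> phi c p + h *: e = phi c q ->
    u q = F (phi c q).
  apply: (lc (fun y => forall q, dom c q -> y = phi c q -> u q = F (phi c q))).
  by rewrite x0; exact: (chart_near cp uF).
apply: near_eq_derive; apply: filterS2 ch (image_near_line cp w0) => h ch [q cq qE] /=.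
by rewrite -qE phiK//; apply: ch.
Qed.

Lemma bsmooth_dom_near c p u F : dom c p -> smooth_near F (phi c p) ->
  (\forall q \near p, u q = F (phi c q)) ->
  \forall q \near p, [/\ dom c q, smooth_near F (phi c q) &
    \forall q' \near q, u q' = F (phi c q')].
Proof.
move=> cp sF uF.
have h1 : \forall q \near p, smooth_near F (phi c q).
  exact: (phi_continuous cp (@near_join _ _ (smooth_at F) sF)).
by apply: filterS3 (dom_near cp) h1 (near_join uF) => q; split.
Qed.

Lemma bsmooth_near c p u : dom c p -> bsmooth c p u ->
  \forall q \near p, bsmooth c q u.
Proof.
move=> cp [F sF uF]; apply: filterS (bsmooth_dom_near cp sF uF) => q [_ sFq uFq].
by exists F.
Qed.

Lemma bsmooth_smooth_on c (A : set M) u : A `<=` dom c ->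
  smooth_on (phi c @` A) (u \o psi c) -> open A ->
  forall p, A p -> bsmooth c p u.
Proof.
move=> Ac su oA p Ap; have [|W [F [oW Wp sF FE]]] := su (phi c p); first by exists p.
exists F; first by apply/smooth_nearP; exists W.
have cp := Ac _ Ap.
have nW : \forall q \near p, W (phi c q).
  by apply: (phi_continuous cp); apply: open_nbhs_nbhs.
have nA : \forall q \near p, A q by apply: open_nbhs_nbhs.
apply: filterS2 nW nA => q Wq Aq.
rewrite FE /= ?phiK//; first exact: Ac.
by apply: mem_set; split => //; exists q.
Qed.

Lemma smooth_inP c u : smooth_in c u <-> forall p, dom c p -> bsmooth c p u.
Proof.
split; first by move=> su; apply: bsmooth_smooth_on su (bm_dom_open _).
move=> su x [p cp <-]; have [F sF uF] := su p cp.
have : nbhs (phi c p) (smooth_at F) by [].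
rewrite nbhsE => -[W1 [oW1 W1p] W1F].
have : nbhs (phi c p) (fun y => forall q, dom c q -> y = phi c q -> u q = F (phi c q)).
  exact: chart_near cp uF.
rewrite nbhsE => -[W2 [oW2 W2p] W2F].
exists (W1 `&` W2), F; split; first exact: openI.
- by [].
- by apply/smooth_openP; [exact: openI|move=> y [/W1F]].
- move=> y /set_mem [[_ /W2F W2y] [q cq qy]] /=; rewrite -qy phiK//.
  by apply/esym; apply: W2y.
Qed.

Lemma bsmooth_eq c p u v : (\forall q \near p, u q = v q) ->
  bsmooth c p u -> bsmooth c p v.
Proof. by move=> uv [F sF uF]; exists F => //; apply: filterS2 uv uF => q <-. Qed.

Lemma bsmooth_cst c p (a : R) : bsmooth c p (cst a).
Proof. by exists (cst a); [exact: smooth_near_cst|apply: (@nearW _ (nbhs p))]. Qed.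

Lemma bsmooth_coord c p i : bsmooth c p (fun q => phi c q 0 i).
Proof.
by exists (fun y => y 0 i); [exact: smooth_near_coord|apply: (@nearW _ (nbhs p))].
Qed.

Lemma bsmoothD c p u v : bsmooth c p u -> bsmooth c p v ->
  bsmooth c p (fun q => u q + v q).
Proof.
move=> [F sF uF] [G sG vG]; exists (fun y => F y + G y); first exact: smooth_nearD.
by apply: filterS2 uF vG => q -> ->.
Qed.

Lemma bsmoothM c p u v : bsmooth c p u -> bsmooth c p v ->
  bsmooth c p (fun q => u q * v q).
Proof.
move=> [F sF uF] [G sG vG]; exists (fun y => F y * G y); first exact: smooth_nearM.
by apply: filterS2 uF vG => q -> ->.
Qed.

Lemma bsmoothN c p u : bsmooth c p u -> bsmooth c p (fun q => - u q).
Proof.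
move=> /(bsmoothM (bsmooth_cst c p (-1))); apply: bsmooth_eq.
by apply: (@nearW _ (nbhs p)) => q /=; rewrite mulN1r.
Qed.

Lemma bsmoothB c p u v : bsmooth c p u -> bsmooth c p v ->
  bsmooth c p (fun q => u q - v q).
Proof. by move=> su sv; exact: bsmoothD su (bsmoothN sv). Qed.

Lemma bsmoothV c p u : u p != 0 -> bsmooth c p u -> bsmooth c p (fun q => (u q)^-1).
Proof.
move=> u0 [F sF uF]; exists (fun y => (F y)^-1).
  by apply: smooth_nearV => //; rewrite -(nbhs_singleton uF).
by apply: filterS uF => q ->.
Qed.

Lemma bsmooth_expinv k c p u : bsmooth c p u ->
  bsmooth c p (fun q => expinv k (u q)).
Proof.
move=> [F sF uF]; exists (expinv k \o F); first exact: smooth_near_expinv.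
by apply: filterS uF => q /= ->.
Qed.

Lemma bsmooth_sum (I : Type) (s : seq I) (P : pred I) (u : I -> M -> R) c p :
  (forall k, P k -> bsmooth c p (u k)) ->
  bsmooth c p (fun q => \sum_(k <- s | P k) u k q).
Proof.
move=> su; elim: s => [|k s IH].
  apply: bsmooth_eq (bsmooth_cst c p 0); apply: (@nearW _ (nbhs p)) => q.
  by rewrite big_nil.
have [Pk|nPk] := boolP (P k).
  apply: bsmooth_eq (bsmoothD (su k Pk) IH); apply: (@nearW _ (nbhs p)) => q.
  by rewrite big_cons Pk.
by apply: bsmooth_eq IH; apply: (@nearW _ (nbhs p)) => q; rewrite big_cons (negbTE nPk).
Qed.

Lemma bsmooth_prod (I : Type) (s : seq I) (P : pred I) (u : I -> M -> R) c p :
  (forall k, P k -> bsmooth c p (u k)) ->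
  bsmooth c p (fun q => \prod_(k <- s | P k) u k q).
Proof.
move=> su; elim: s => [|k s IH].
  apply: bsmooth_eq (bsmooth_cst c p 1); apply: (@nearW _ (nbhs p)) => q.
  by rewrite big_nil.
have [Pk|nPk] := boolP (P k).
  apply: bsmooth_eq (bsmoothM (su k Pk) IH); apply: (@nearW _ (nbhs p)) => q.
  by rewrite big_cons Pk.
by apply: bsmooth_eq IH; apply: (@nearW _ (nbhs p)) => q; rewrite big_cons (negbTE nPk).
Qed.

Lemma bsmooth_continuous c p u : dom c p -> bsmooth c p u -> {for p, continuous u}.
Proof.
move=> cp [F sF uF].
have cF := smooth_at_continuous (smooth_near_at sF).
have cc : {for p, continuous (F \o phi c)}.
  by apply: continuous_comp => //; exact: phi_continuous.
rewrite /prop_for /continuous_at (nbhs_singleton uF).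
apply: cvg_trans cc; apply: near_eq_cvg.
by apply: filterS uF => q.
Qed.

Lemma bsmooth_transition c c' p i : dom c p -> dom c' p ->
  bsmooth c p (fun q => phi c' q 0 i).
Proof.
move=> cp c'p; apply: (@bsmooth_smooth_on c (dom c `&` dom c')) => //.
- exact: bm_transition_smooth.
- by apply: openI; exact: bm_dom_open.
Qed.

Lemma bsmooth_change c c' p u : dom c p -> dom c' p ->
  bsmooth c' p u -> bsmooth c p u.
Proof.
move=> cp c'p [F sF uF].
have /choice [T TP] : forall i, exists G : E -> R, smooth_near G (phi c p) /\
    \forall q \near p, phi c' q 0 i = G (phi c q).
  by move=> i; have [G] := bsmooth_transition i cp c'p; exists G.
pose f (y : E) : E := \row_i T i y.
have fE : \forall q \near p, phi c' q = f (phi c q).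
  have : \forall q \near p, forall i, phi c' q 0 i = T i (phi c q).
    by apply: (@filter_forall _ _ _ (nbhs p)) => i; case: (TP i).
  by apply: filterS => q h; apply/rowP => i; rewrite mxE.
exists (F \o f); last by apply: filterS2 uF fE => q -> ->.
apply: smooth_near_comp; first by rewrite -(nbhs_singleton fE).
move=> i; rewrite (_ : (fun y => f y 0 i) = T i); first by case: (TP i).
by apply/funext => y; rewrite mxE.
Qed.

Lemma bsmooth_bweight c p i : bsmooth c p (bweight c i).
Proof.
rewrite /bweight; case: (i == ord0); first exact: bsmooth_coord.
exact: bsmooth_cst.
Qed.

Lemma bsmooth_bderiv c p i u : dom c p -> bsmooth c p u -> bsmooth c p (bderiv c i u).
Proof.
move=> cp [F sF uF].
apply: (@bsmooth_eq _ _ (fun q => bweight c i q * pderiv i F (phi c q))).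
  apply: filterS (bsmooth_dom_near cp sF uF) => q [cq _ uFq].
  by rewrite (bderiv_at i cq uFq).
apply: bsmoothM (bsmooth_bweight c p i) _; exists (pderiv i F); first exact: smooth_near_pderiv.
by apply: (@nearW _ (nbhs p)).
Qed.

Lemma bderiv_near c p i u v : dom c p -> bsmooth c p u -> (\forall q \near p, u q = v q) ->
  bderiv c i u p = bderiv c i v p.
Proof.
move=> cp [F sF uF] uv; rewrite (bderiv_at i cp uF) (@bderiv_at c p i v F)//.
by apply: filterS2 uv uF => q <-.
Qed.

Lemma bderivD c p i u v : dom c p -> bsmooth c p u -> bsmooth c p v ->
  bderiv c i (fun q => u q + v q) p = bderiv c i u p + bderiv c i v p.
Proof.
move=> cp [F sF uF] [G sG vG].
rewrite (bderiv_at i cp uF) (bderiv_at i cp vG).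
rewrite (@bderiv_at c p i _ (F \+ G))//; last by apply: filterS2 uF vG => q /= -> ->.
rewrite /pderiv deriveD ?mulrDr//; apply/smooth_at_derivable/smooth_near_at => //.
Qed.

Lemma bderivM c p i u v : dom c p -> bsmooth c p u -> bsmooth c p v ->
  bderiv c i (fun q => u q * v q) p = u p * bderiv c i v p + v p * bderiv c i u p.
Proof.
move=> cp [F sF uF] [G sG vG].
rewrite (bderiv_at i cp uF) (bderiv_at i cp vG).
rewrite (@bderiv_at c p i _ (F \* G))//; last by apply: filterS2 uF vG => q /= -> ->.
rewrite /pderiv deriveM; [|exact/smooth_at_derivable/smooth_near_at..].
rewrite (nbhs_singleton uF) (nbhs_singleton vG) /GRing.scale /=; ring.
Qed.

Lemma bderiv_cst c p i (a : R) : bderiv c i (cst a) p = 0.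
Proof.
by rewrite /bderiv /pderiv (_ : _ \o _ = cst a) ?derive_cst ?mulr0//; exact/funext.
Qed.

Lemma bderivN c p i u : dom c p -> bsmooth c p u ->
  bderiv c i (fun q => - u q) p = - bderiv c i u p.
Proof.
move=> cp su; rewrite (_ : (fun q => _) = fun q => cst (-1) q * u q); last first.
  by apply/funext => q; rewrite mulN1r.
by rewrite bderivM// ?bderiv_cst ?mulr0 ?addr0 ?mulN1r//; exact: bsmooth_cst.
Qed.

Lemma bderiv_coord c p i j : dom c p ->
  bderiv c i (fun q => phi c q 0 j) p = (j == i)%:R * bweight c i p.
Proof.
move=> cp; rewrite (@bderiv_at c p i _ (fun y => y 0 j))//.
  by rewrite pderiv_coord mulrC.
by apply: (@nearW _ (nbhs p)).
Qed.

(** A weight depends at most on [t], and does so only in direction [0]; for [i != j] no derivative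
    of a weight survives, and the claim reduces to [pderivC]. *)
Lemma bderivC c p i j u : dom c p -> bsmooth c p u ->
  bderiv c i (bderiv c j u) p = bderiv c j (bderiv c i u) p.
Proof.
move=> cp [F sF uF].
pose w (k : 'I_3) (y : E) : R := if k == ord0 then y 0 0 else 1.
have sw k x : smooth_near (w k) x.
  by rewrite /w; case: eqP => _; [exact: smooth_near_coord|exact: smooth_near_cst].
have D k : \forall q \near p, bderiv c k u q = (fun y => w k y * pderiv k F y) (phi c q).
  apply: filterS (bsmooth_dom_near cp sF uF) => q [cq _ uFq].
  by rewrite (bderiv_at k cq uFq).
apply: etrans (bderiv_at i cp (D j)) _.
apply: etrans (esym (bderiv_at j cp (D i))).
have dw k l : pderiv k (w l) (phi c p) = ((l == 0) && (l == k))%:R.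
  rewrite /w; have [l0|l0] := eqVneq l 0; last by rewrite /pderiv derive_cst.
  by rewrite pderiv_coord l0.
have sFp := smooth_near_at sF.
have PM k l : pderiv k (fun y => w l y * pderiv l F y) (phi c p) =
    w l (phi c p) * pderiv k (pderiv l F) (phi c p)
    + pderiv l F (phi c p) * ((l == 0) && (l == k))%:R.
  rewrite -dw [LHS](@deriveM _ _ (w l) (pderiv l F)).
  - by [].
  - exact/smooth_at_derivable/smooth_near_at.
  - exact/smooth_at_derivable/smooth_at_pderiv.
apply: etrans (congr1 ( *%R (bweight c i p)) (PM i j)) _.
apply: etrans (esym (congr1 ( *%R (bweight c j p)) (PM j i))).
rewrite (@pderivC _ F _ i j); last exact: (sFp 2%N).
rewrite -[bweight c i p]/(w i (phi c p)) -[bweight c j p]/(w j (phi c p)).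
have [->|ij] := eqVneq i j; first by [].
by rewrite !andbF !mulr0 !addr0 mulrCA.
Qed.

Lemma offZ_near p : ~ hypersurface p -> \forall q \near p, ~ hypersurface q.
Proof.
have [c cp] := bm_cover p; move=> /(bm_hypersurface cp)/eqP t0.
have nt := near_neq0 (bsmooth_continuous cp (bsmooth_coord c p ord0)) t0.
by apply: filterS2 nt (dom_near cp) => q t0' cq /(bm_hypersurface cq)/eqP; apply/negP.
Qed.

Lemma bweight_offZ c p i : dom c p -> ~ hypersurface p -> bweight c i p != 0.
Proof.
move=> cp nZ; rewrite /bweight; case: (i == ord0); last exact: oner_neq0.
by apply/eqP => /(bm_hypersurface cp).
Qed.

Lemma btransitionE c c' p i j : dom c p ->
  btransition c c' p i j = (bweight c' i p)^-1 * bderiv c j (fun q => phi c' q 0 i) p.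
Proof. by move=> cp; rewrite !mxE -mulrA; congr (_ * _); rewrite mulrC. Qed.

(** Chain rule in plain coordinates; off [Z] the weights of [c'] are invertible and can be inserted
    and cancelled. *)
Lemma bderiv_chain c c' p j u : dom c p -> dom c' p -> ~ hypersurface p -> bsmooth c' p u ->
  bderiv c j u p = \sum_i bderiv c' i u p * btransition c c' p i j.
Proof.
move=> cp c'p nZ [F sF uF].
have /choice [T TP] : forall i, exists G : E -> R, smooth_near G (phi c p) /\
    \forall q \near p, phi c' q 0 i = G (phi c q).
  by move=> i; have [G] := bsmooth_transition i cp c'p; exists G.
pose f (y : E) : E := \row_i T i y.
have fi i : (fun y => f y 0 i) = T i by apply/funext => y; rewrite mxE.
have fE : \forall q \near p, phi c' q = f (phi c q).
  have : \forall q \near p, forall i, phi c' q 0 i = T i (phi c q).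
    by apply: (@filter_forall _ _ _ (nbhs p)) => i; case: (TP i).
  by apply: filterS => q h; apply/rowP => i; rewrite mxE.
have uFf : \forall q \near p, u q = (F \o f) (phi c q).
  by apply: filterS2 uF fE => q -> ->.
rewrite (bderiv_at j cp uFf).
have [dF DF] := nbhs_singleton (Cn1_differentiable (smooth_near_at sF 1%N)).
rewrite (nbhs_singleton fE) in dF DF.
have df i : derivable (fun y => f y 0 i) (phi c p) (delta_mx 0 j).
  by rewrite fi; apply/smooth_at_derivable/smooth_near_at; case: (TP i).
have := chain_rule dF df; rewrite DF => Dc.
rewrite /pderiv (derive_val (is_derive := Dc)) mulr_sumr; apply: eq_bigr => i _.
rewrite btransitionE// (bderiv_at i c'p uF) (bderiv_at j cp (TP i).2) mxE fi.
rewrite -(nbhs_singleton fE) [bweight c' i p * _]mulrC -mulrA mulVKf ?bweight_offZ//.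
by rewrite mulrCA.
Qed.

(** This is [bderiv_chain] for the coordinate functions of [c'']. *)
Lemma btransition_comp c c' c'' p : dom c p -> dom c' p -> dom c'' p -> ~ hypersurface p ->
  btransition c c'' p = btransition c' c'' p *m btransition c c' p.
Proof.
move=> cp c'p c''p nZ; apply/matrixP => i j; rewrite [RHS]mxE btransitionE//.
rewrite (bderiv_chain j cp c'p nZ (bsmooth_transition i c'p c''p)) mulr_sumr.
by apply: eq_bigr => k _; rewrite (@btransitionE c' c'' p i k c'p) mulrA.
Qed.

Lemma btransition_id c p : dom c p -> ~ hypersurface p -> btransition c c p = 1%:M.
Proof.
move=> cp nZ; apply/matrixP => i j; rewrite btransitionE// bderiv_coord// mxE.
by case: eqP => [->|_]; rewrite ?mul0r ?mulr0// mul1r mulVf// bweight_offZ.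
Qed.

(** From a point of [Z] one moves in the direction of increasing [t], which stays in the half-space
    at a boundary point too. *)
Lemma offZ_dense p (P : set M) : (\forall q \near p, P q) ->
  exists2 q, P q & ~ hypersurface q.
Proof.
have [c cp] := bm_cover p => pP.
have [/(bm_hypersurface cp) t0|nZ] := pselect (hypersurface p); last first.
  by exists p => //; exact: nbhs_singleton pP.
have [U openU UE] := @bm_image _ M c.
have : (U `&` half_space (half c)) (phi c p) by rewrite -UE; exists p.
move=> [Ocp Hcp].
have lc : {for (0 : R), continuous (fun h : R => phi c p + h *: delta_mx 0 0 : E)}.
  apply: (@continuousD R E R (cst (phi c p)) (fun h : R => h *: delta_mx 0 0)).
    exact: (@cst_continuous R E).
  exact: scalel_continuous.
have x0 : phi c p + 0 *: delta_mx 0 0 = phi c p by rewrite scale0r addr0.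
have lO : \forall h \near (0 : R), U (phi c p + h *: delta_mx 0 0).
  by apply: lc; rewrite x0; apply: open_nbhs_nbhs.
have lP : \forall h \near (0 : R), forall q, dom c q ->
    phi c p + h *: delta_mx 0 0 = phi c q -> P q.
  apply: (lc (fun y => forall q, dom c q -> y = phi c q -> P q)).
  by rewrite x0; exact: (chart_near cp pP).
have [d /= d0 dP] := (nbhs_ballP (0 : R) _).1 (@filterI _ (nbhs (0:R)) _ _ _ lO lP).
have d2 : 0 < d / 2 by rewrite divr_gt0.
have [|Od Pd] := dP (d / 2).
  by rewrite -ball_normE /= sub0r normrN gtr0_norm// ltr_pdivrMr// ltr_pMr// ltr1n.
have c0 : (phi c p + (d / 2) *: delta_mx 0 0) 0 ord0 = d / 2.
  by rewrite !mxE t0 add0r !eqxx mulr1.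
have : (phi c @` dom c) (phi c p + (d / 2) *: delta_mx 0 0).
  by rewrite UE; split => // _; rewrite c0 ltW.
move=> [q cq qE]; exists q; first by apply: Pd.
by move=> /(bm_hypersurface cq)/eqP; rewrite qE c0 gt_eqF.
Qed.

(** Both values are compared with those at a nearby point off [Z], where [u] and [v] coincide.
    Identities that the bundles prescribe only off [Z] are carried to [Z] in this way. *)
Lemma agree_offZ p u v : {for p, continuous u} -> {for p, continuous v} ->
  (\forall q \near p, ~ hypersurface q -> u q = v q) -> u p = v p.
Proof.
move=> cu cv uv; apply/eqP; rewrite -subr_eq0 -normr_le0.
apply/ler_addgt0Pl => e e0; rewrite addr0.
have e20 : 0 < e / 2 by rewrite divr_gt0.
have nu : \forall q \near p, `|u p - u q| <= e / 2.
  by have /cvgrPdist_le/(_ (e / 2)) := cu; exact.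
have nv : \forall q \near p, `|v p - v q| <= e / 2.
  by have /cvgrPdist_le/(_ (e / 2)) := cv; exact.
have [|q [h1 h2 h3] nZ] := @offZ_dense p (fun q => [/\ `|u p - u q| <= e / 2,
    `|v p - v q| <= e / 2 & ~ hypersurface q -> u q = v q]).
  by apply: filterS3 nu nv uv => q; split.
rewrite (splitr e) -(subrKA (u q)) (le_trans (ler_normD _ _))// lerD//.
by rewrite h3// distrC.
Qed.

End Manifold.

(** * Transition matrices across Z *)

Section Extension.
Variables (R : realType) (M : bmanifold3 R).
Local Notation E := 'rV[R]_3.
Local Notation C := (chart M).
Implicit Types (c d : C) (p q : M) (i j : 'I_3) (u v : M -> R).

(** [Hadamard] asks that the extension [F] vanish on a whole piece of the plane [t = 0]. Near
    [phi c p] that plane lies in the chart image, at a boundary point too, because the half-space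
    contains it; so [F] equals [u] there, which is zero on [Z]. *)
Lemma bsmooth_Hadamard c p u : dom c p -> hypersurface p -> bsmooth c p u ->
  (\forall q \near p, hypersurface q -> u q = 0) ->
  exists2 v, bsmooth c p v & \forall q \near p, u q = phi c q 0 0 * v q.
Proof.
move=> cp Zp [F sF uF] u0.
have t0 := (bm_hypersurface cp).1 Zp.
have [U openU UE] := @bm_image _ M c.
have [Ucp _] : (U `&` half_space (half c)) (phi c p) by rewrite -UE; exists p.
have nU : \forall y \near phi c p, U y by apply: open_nbhs_nbhs.
have nP := chart_near cp (@filterI _ (nbhs p) (nbhs_filter p) _ _ uF u0).
have F0 : \forall y \near phi c p, (y : E) 0 0 = 0 -> F y = 0.
  apply: filterS2 nU nP => y Uy Py y0.
  have : (phi c @` dom c) y by rewrite UE; split => // _; rewrite y0.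
  move=> [q cq qy]; have [E1 E2] := Py q cq (esym qy).
  rewrite -qy -E1; apply: E2; apply/(bm_hypersurface cq); by rewrite qy.
have [G sG FG] := Hadamard t0 sF F0.
exists (G \o phi c); first by exists G => //; apply: (@nearW _ (nbhs p)).
have FG' : \forall q \near p, F (phi c q) = phi c q 0 0 * G (phi c q).
  exact: (phi_continuous cp FG).
by apply: filterS2 uF FG' => q -> ->.
Qed.

Lemma transition_factor c d p : dom c p -> dom d p -> hypersurface p ->
  exists G, [/\ bsmooth c p G, G p != 0 & \forall q \near p, phi d q 0 0 = phi c q 0 0 * G q].
Proof.
move=> cp dp Zp.
(* The factors of the two changes of chart are inverse to each other off [Z],
   hence on [Z] by continuity. *)
have fact c' d' : dom c' p -> dom d' p ->
    exists2 v, bsmooth c' p v & \forall q \near p, phi d' q 0 0 = phi c' q 0 0 * v q.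
  move=> c'p d'p; apply: bsmooth_Hadamard => //; first exact: bsmooth_transition.
  by apply: filterS (dom_near d'p) => q d'q /(bm_hypersurface d'q).
have [G sG GE] := fact c d cp dp.
have [H sH HE] := fact d c dp cp.
exists G; split=> //.
have GH : G p * H p = cst 1 p.
  apply: (@agree_offZ _ _ p (fun q => G q * H q) (cst 1)).
  - by apply: continuousM; [exact: bsmooth_continuous sG|exact: bsmooth_continuous sH].
  - exact: (bsmooth_continuous cp (bsmooth_cst c p 1)).
  - apply: filterS3 GE HE (dom_near cp) => q EG EH cq nZ.
    have t0 : phi c q 0 0 != 0 by apply/eqP => /(bm_hypersurface cq).
    by apply: (mulfI t0); rewrite mulrA -EG -EH mulr1.
by apply/eqP => G0; move: GH; rewrite G0 mul0r /= => /eqP; rewrite eq_sym oner_eq0.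
Qed.

Lemma btransition_ext c d p i j : dom c p -> dom d p ->
  exists2 B, bsmooth c p B &
    \forall q \near p, ~ hypersurface q -> btransition c d q i j = B q.
Proof.
move=> cp dp.
have sD := bsmooth_bderiv j cp (bsmooth_transition i cp dp).
have cE : \forall q \near p, btransition c d q i j
    = (bweight d i q)^-1 * bderiv c j (fun q => phi d q 0 i) q.
  by apply: filterS (dom_near cp) => q cq; rewrite btransitionE.
have [Zp|nZ] := pselect (hypersurface p); last first.
  exists (fun q => (bweight d i q)^-1 * bderiv c j (fun q => phi d q 0 i) q).
    apply: bsmoothM sD; apply: bsmoothV; first exact: bweight_offZ.
    by apply: bsmooth_change dp _ => //; exact: bsmooth_bweight.
  by apply: filterS cE => q.
have [i0|i0] := eqVneq i ord0; last first.
  exists (bderiv c j (fun q => phi d q 0 i)) => //.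
  by apply: filterS cE => q -> _; rewrite /bweight (negbTE i0) invr1 mul1r.
subst i.
have [G [sG G0 GE]] := transition_factor cp dp Zp.
(* [t' = t G], so [dt'/t' = dt/t + dG/G]. *)
exists (fun q => (j == ord0)%:R + bderiv c j G q * (G q)^-1).
  apply: bsmoothD; first exact: bsmooth_cst.
  by apply: bsmoothM; [exact: bsmooth_bderiv|exact: bsmoothV].
have nG := near_neq0 (bsmooth_continuous cp sG) G0.
have n1 : \forall q \near p, dom c q /\ dom d q.
  by apply: filterS2 (dom_near cp) (dom_near dp) => q; split.
have n2 : \forall q \near p, bsmooth c q G /\ G q != 0.
  by apply: filterS2 (bsmooth_near cp sG) nG => q; split.
have n3 : \forall q \near p, btransition c d q ord0 j
    = (bweight d ord0 q)^-1 * bderiv c j (fun q => phi d q 0 ord0) q /\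
   \forall q' \near q, phi d q' 0 0 = phi c q' 0 0 * G q'.
  by apply: filterS2 cE (near_join GE) => q; split.
apply: filterS3 n1 n2 n3 => q [cq dq] [sGq Gq0] [-> GEq] nZ.
rewrite (bderiv_near j cq (bsmooth_transition ord0 cq dq) GEq).
rewrite bderivM//; last exact: bsmooth_coord.
rewrite bderiv_coord// /bweight eqxx (nbhs_singleton GEq).
have t0 : phi c q 0 0 != 0 by apply/eqP => /(bm_hypersurface cq).
rewrite (eq_sym 0 j); case: (j == ord0); first by field; rewrite Gq0.
by rewrite /= !mul0r mulr0 addr0 add0r; field; rewrite Gq0.
Qed.

(** The local extensions are glued along the diagonal, [w' p = B p p]. For [q] near [p], the
    functions [B p] and [B q] agree off [Z] near [q], hence at [q] by density; so [w'] coincides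
    near [p] with the smooth [B p]. *)
Lemma extend_offZ c (D : set M) (w : M -> R) : open D -> D `<=` dom c ->
  (forall p, D p -> exists2 B, bsmooth c p B &
    \forall q \near p, ~ hypersurface q -> w q = B q) ->
  exists w', forall p, D p -> bsmooth c p w' /\ (~ hypersurface p -> w' p = w p).
Proof.
move=> oD Dc wB.
have /choice [B BP] : forall p, exists B, D p ->
    bsmooth c p B /\ \forall q \near p, ~ hypersurface q -> w q = B q.
  move=> p; have [Dp|nDp] := pselect (D p); last by exists (cst 0).
  by have [B sB BE] := wB p Dp; exists B.
exists (fun p => B p p) => p Dp; have [sB BE] := BP p Dp; split; last first.
  by move=> nZ; rewrite (nbhs_singleton BE).
apply: bsmooth_eq sB.
have cp := Dc _ Dp.
have nD : \forall q \near p, D q by apply: open_nbhs_nbhs.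
apply: filterS3 nD (bsmooth_near cp (BP p Dp).1) (near_join BE) => q Dq sBq BEq.
have [sBq' BEq'] := BP q Dq; have cq := Dc _ Dq.
apply: agree_offZ; [exact: bsmooth_continuous sBq|exact: bsmooth_continuous sBq'|].
by apply: filterS2 BEq BEq' => q' h1 h2 nZ; rewrite -h1// h2.
Qed.

(** The inverse relation, known off [Z] from [btransition_comp], reaches [Z] by continuity; it is
    what keeps pulled-back metrics definite there. *)
Lemma btransition_extension : exists B : C -> C -> M -> 'M[R]_3,
  [/\ forall c d p i j, dom c p -> dom d p -> bsmooth c p (fun q => B c d q i j),
      forall c d p, dom c p -> dom d p -> ~ hypersurface p -> B c d p = btransition c d p &
      forall c d p, dom c p -> dom d p -> B d c p *m B c d p = 1%:M].
Proof.
have /choice [b bP] : forall x : C * C * 'I_3 * 'I_3, exists w : M -> R, forall p,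
    dom x.1.1.1 p -> dom x.1.1.2 p -> bsmooth x.1.1.1 p w /\
    (~ hypersurface p -> w p = btransition x.1.1.1 x.1.1.2 p x.1.2 x.2).
  move=> [[[c d] i] j] /=.
  have [||p [cp dp]|w wP] := @extend_offZ c (dom c `&` dom d) (fun p => btransition c d p i j).
  - by apply: openI; exact: bm_dom_open.
  - by move=> p [].
  - exact: btransition_ext.
  - by exists w => p cp dp; exact: wP.
pose B c d p : 'M[R]_3 := \matrix_(i, j) b (c, d, i, j) p.
have sB c d p i j : dom c p -> dom d p -> bsmooth c p (fun q => B c d q i j).
  move=> cp dp; have [] := bP (c, d, i, j) p cp dp => /= + _.
  by apply: bsmooth_eq; apply: (@nearW _ (nbhs p)) => q; rewrite mxE.
have BE c d p : dom c p -> dom d p -> ~ hypersurface p -> B c d p = btransition c d p.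
  move=> cp dp nZ; apply/matrixP => i j; rewrite mxE.
  by have [_ /= ->] := bP (c, d, i, j) p cp dp.
exists B; split=> // c d p cp dp; apply/matrixP => i j.
apply: (@agree_offZ _ _ p (fun q => (B d c q *m B c d q) i j) (fun q => (1%:M : 'M[R]_3) i j)).
- apply: (@bsmooth_continuous _ _ c) => //.
  have : bsmooth c p (fun q => \sum_k B d c q i k * B c d q k j).
    apply: bsmooth_sum => k _; apply: bsmoothM; last exact: sB.
    by apply: (bsmooth_change cp dp); exact: sB.
  by apply: bsmooth_eq; apply: (@nearW _ (nbhs p)) => q; rewrite mxE.
- exact: (bsmooth_continuous cp (bsmooth_cst c p _)).
- apply: filterS2 (dom_near cp) (dom_near dp) => q cq dq nZ.
  by rewrite !BE// -btransition_comp// btransition_id.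
Qed.

End Extension.

(** * Existence of a b-metric *)

Lemma near_gt (R : realType) (T : topologicalType) (u : T -> R) (p : T) (a : R) :
  {for p, continuous u} -> a < u p -> \forall q \near p, a < u q.
Proof.
move=> cu up; apply: (cu [set r | a < r]).
by apply: open_nbhs_nbhs; split => //; exact: open_gt.
Qed.

Section MetricExistence.
Variables (R : realType) (M : bmanifold3 R).
Local Notation E := 'rV[R]_3.
Local Notation C := (chart M).
Implicit Types (c d : C) (p q : M) (i j : 'I_3) (u v : M -> R).

Lemma closed_halfspace (b : bool) : closed (half_space (R := R) b).
Proof.
case: b; last first.
  by rewrite (_ : half_space _ = setT); [exact: closedT|apply/seteqP; split].
rewrite (_ : half_space _ = (fun y : E => y 0 ord0) @^-1` [set t | 0 <= t]); last first.
  by apply/seteqP; split=> y /= h; [exact: h|move=> _].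
apply: closed_comp; last exact: closed_ge.
by move=> y _; exact: coord_continuous.
Qed.

(** The last clause allows sections multiplied by [rho] to be extended by zero outside the chart. It
    holds because [rho] vanishes off [K], which is compact and hence closed in a Hausdorff space. *)
Lemma bump_function p : exists rho d, [/\ dom d p, 0 < rho p, forall q, 0 <= rho q,
  forall c q, dom c q -> bsmooth c q rho &
  forall q, ~ dom d q -> \forall q' \near q, rho q' = 0].
Proof.
have [d dp] := bm_cover p.
have [U openU UE] := @bm_image _ M d.
set a := phi d p.
have [Ua _] : (U `&` half_space (half d)) a by rewrite -UE; exists p.
have [r /= r0 rU] := (nbhs_ballP a _).1 (open_nbhs_nbhs (conj openU Ua)).
pose s := r / 2.
have s0 : 0 < s by rewrite divr_gt0.
pose B := [set y : E | `|y - a| <= s] `&` half_space (half d).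
have BU : B `<=` phi d @` dom d.
  move=> y [By hy]; rewrite UE; split => //; apply: rU; rewrite -ball_normE /= distrC.
  by rewrite (le_lt_trans By)// ltr_pdivrMr// ltr_pMr// ltr1n.
have cB : compact B.
  by apply: compact_closedI; [exact: compact_ball|exact: closed_halfspace].
pose K := psi d @` B.
have cK : compact K.
  apply: continuous_compact => //; apply: continuous_subspaceW BU _.
  exact: bm_psi_continuous.
have clK : closed K by apply: compact_closed => //; exact: bm_hausdorff.
(* The Euclidean distance is used because its square is smooth. As it dominates every coordinate,
   [g] is positive only inside the ball of the maximum norm that defines [B]. *)
pose g q := s ^+ 2 - \sum_i (phi d q 0 i - a 0 i) ^+ 2.
pose rho q := if pselect (dom d q) then expinv 0 (g q) else 0.
have rhoK q : ~ K q -> rho q = 0.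
  rewrite /rho; case: pselect => // dq nK; apply: expinv_eq0.
  rewrite /g subr_le0.
  have [//|lt] := leP (s ^+ 2) (\sum_i (phi d q 0 i - a 0 i) ^+ 2).
  exfalso; apply: nK; exists (phi d q); last exact: phiK.
  split; last by have : (phi d @` dom d) (phi d q) by [exists q]; rewrite UE => -[].
  apply: normr_rV_le => [|i]; first exact: ltW.
  rewrite !mxE -(ler_pXn2r (n := 2))// ?nnegrE ?ltW// real_normK ?num_real//.
  apply: le_lt_trans _ lt; rewrite (bigD1 i)//= lerDl sumr_ge0// => k _; exact: sqr_ge0.
have nK q : ~ K q -> \forall q' \near q, rho q' = 0.
  move=> nK; have oK : open (~` K) by exact: closed_openC.
  by apply: filterS (open_nbhs_nbhs (conj oK nK)) => q'; exact: rhoK.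
have ndK q : ~ dom d q -> ~ K q.
  move=> nd [y /BU[q' dq' <-]]; rewrite phiK// => qq; by rewrite qq in dq'.
exists rho, d; split=> //.
- rewrite /rho; case: pselect => //= _; rewrite expinv_gt0 /g big1 ?subr0 ?exprn_gt0//.
  by move=> i _; rewrite subrr expr0n.
- by move=> q; rewrite /rho; case: pselect => /= _ //; exact: expinv_ge0.
- move=> c q cq; have [dq|nd] := pselect (dom d q); last first.
    by apply: bsmooth_eq (bsmooth_cst c q 0); apply: filterS (nK q (ndK q nd)) => q' ->.
  apply: (bsmooth_change cq dq).
  apply: (@bsmooth_eq _ _ _ _ (fun q => expinv 0 (g q))).
    by apply: filterS (dom_near dq) => q' dq'; rewrite /rho; case: pselect.
  apply: bsmooth_expinv; apply: bsmoothB; first exact: bsmooth_cst.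
  apply: bsmooth_sum => i _; rewrite (_ : (fun q => _) =
      fun q => (phi d q 0 i - cst (a 0 i) q) * (phi d q 0 i - cst (a 0 i) q)); last first.
    by apply/funext => q'; rewrite expr2.
  have h := bsmoothB (bsmooth_coord d q i) (bsmooth_cst d q (a 0 i)).
  exact: bsmoothM.
- by move=> q /ndK; exact: nK.
Qed.

(** A semidefinite section over all of [M], definite where [rho] is positive; sums of such sections
    with nonnegative smooth weights obey the same transformation rule. *)
Definition local_metric (rho : M -> R) (g : bbilinear M) :=
  [/\ forall q, 0 <= rho q, forall c q, dom c q -> bsmooth c q rho,
      forall c q i j, dom c q -> bsmooth c q (fun q' => g c q' i j) &
  [/\ forall c q, dom c q -> (g c q)^T = g c q,
      forall c q (v : 'cV[R]_3), dom c q -> 0 <= (v^T *m g c q *m v) 0 0,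
      forall c q (v : 'cV[R]_3), dom c q -> 0 < rho q -> v != 0 ->
        0 < (v^T *m g c q *m v) 0 0 &
      on_overlaps (fun c c' q =>
        g c q = (btransition c c' q)^T *m g c' q *m btransition c c' q)]].

Lemma sqr_col_ge0 (v : 'cV[R]_3) : 0 <= (v^T *m v) 0 0.
Proof. by rewrite mxE sumr_ge0// => i _; rewrite mxE -expr2 sqr_ge0. Qed.

Lemma sqr_col_gt0 (v : 'cV[R]_3) : v != 0 -> 0 < (v^T *m v) 0 0.
Proof.
move=> v0; rewrite lt_def sqr_col_ge0 andbT; apply: contra v0 => /eqP h.
apply/eqP/colP => i; rewrite mxE; apply/eqP; rewrite -sqrf_eq0.
have h' : \sum_k v k 0 ^+ 2 = 0.
  by apply: etrans h; rewrite mxE; apply: eq_bigr => k _; rewrite mxE expr2.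
have := psumr_eq0P (fun k _ => sqr_ge0 (v k 0)) h'.
by move=> ->.
Qed.

Lemma local_metric_exists p : exists rho g, local_metric rho g /\ 0 < rho p.
Proof.
have [B [sB BE BV]] := btransition_extension M.
have [rho [d [dp rp r0 sr nr]]] := bump_function p.
have domr q : rho q != 0 -> dom d q.
  by move=> h; apply: contrapT => /nr /nbhs_singleton /eqP; apply/negP.
pose g : bbilinear M := fun c q => rho q *: ((B c d q)^T *m B c d q).
have gE c q (v : 'cV[R]_3) :
    (v^T *m g c q *m v) 0 0 = rho q * ((B c d q *m v)^T *m (B c d q *m v)) 0 0.
  by rewrite /g -scalemxAr -scalemxAl mxE trmx_mul !mulmxA.
exists rho, g; split=> //; split=> //; last split.
- move=> c q i j cq; have [dq|nd] := pselect (dom d q); last first.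
    apply: bsmooth_eq (bsmooth_cst c q 0); apply: filterS (nr q nd) => q' h.
    by rewrite /g h scale0r mxE.
  have : bsmooth c q (fun q' => rho q' * \sum_k B c d q' k i * B c d q' k j).
    apply: bsmoothM; first exact: sr.
    by apply: bsmooth_sum => k _; apply: bsmoothM; exact: sB.
  apply: bsmooth_eq; apply: (@nearW _ (nbhs q)) => q'; rewrite !mxE; congr (_ * _).
  by apply: eq_bigr => k _; rewrite mxE.
- by move=> c q cq; rewrite /g linearZ /= trmx_mul trmxK.
- by move=> c q v cq; rewrite gE mulr_ge0// sqr_col_ge0.
- move=> c q v cq rq v0; rewrite gE mulr_gt0// sqr_col_gt0//.
  have dq := domr q (lt0r_neq0 rq).
  by apply: contra v0 => /eqP h; rewrite -[v]mul1mx -(BV c d q cq dq) -mulmxA h mulmx0.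
- move=> c c' q cq c'q nZ; rewrite /g.
  (* The point may lie outside the chart [d], where nothing is known about [B]; there [rho q = 0]
     and both sides vanish. *)
  have [->|rn0] := eqVneq (rho q) 0; first by rewrite !scale0r mulmx0 mul0mx.
  have dq := domr q rn0.
  rewrite !BE// -scalemxAr -scalemxAl; congr (_ *: _).
  by rewrite (btransition_comp cq c'q dq nZ) trmx_mul !mulmxA.
Qed.

(** Second countability reduces to countably many choices: for each basic open set on which some
    local metric has positive [rho], one such metric is selected, and the remaining indices get the
    zero section. Local finiteness itself comes from the weights put on the family in
    [bmetric_exists]. *)
Lemma locally_finite_family : exists (rho : nat -> M -> R) (g : nat -> bbilinear M),
  (forall n, local_metric (rho n) (g n)) /\ forall p, exists n, 0 < rho n p.
Proof.
have [B cB [oB bB]] := bm_second_countable M.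
have /countable_injP[f finj] := cB.
pose good (N : set M) (x : (M -> R) * bbilinear M) :=
  local_metric x.1 x.2 /\ forall q, N q -> 0 < x.1 q.
have zero_local : local_metric (cst 0) (fun _ _ => 0).
  split=> // [c q _|c q i j _|]; first exact: bsmooth_cst.
    apply: bsmooth_eq (bsmooth_cst c q 0).
    by apply: (@nearW _ (nbhs q)) => q'; rewrite mxE.
  split=> // [c q _|c q v _|c q v _|c c' q _ _ _].
  - by rewrite trmx0.
  - by rewrite mulmx0 mul0mx mxE.
  - by rewrite /= ltxx.
  - by rewrite mulmx0 mul0mx.
have /choice [x xP] : forall n : nat, exists x : (M -> R) * bbilinear M,
    local_metric x.1 x.2 /\
    forall N, B N -> f N = n -> (exists y, good N y) -> forall q, N q -> 0 < x.1 q.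
  move=> n; have [[N [BN fN [y [y1 y2]]]]|no] :=
    pselect (exists N, [/\ B N, f N = n & exists y, good N y]).
    exists y; split=> // N' BN' fN' _ q.
    have -> : N' = N by apply: finj; rewrite ?inE// fN fN'.
    exact: y2.
  exists (cst 0, fun _ _ => 0); split=> // N BN fN ex; exfalso.
  by apply: no; exists N.
exists (fun n => (x n).1), (fun n => (x n).2); split; first by move=> n; case: (xP n).
move=> p; have [rho [g [lg rp]]] := local_metric_exists p.
have [c cp] := bm_cover p.
have nr : \forall q \near p, 0 < rho q.
  have [_ sr _ _] := lg.
  exact: (near_gt (bsmooth_continuous cp (sr c p cp)) rp).
have [N [BN Np] Nr] := bB p _ nr.
exists (f N); have [_] := xP (f N); apply; [exact: BN|by []| |exact: Np].
by exists (rho, g); split.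
Qed.

Lemma bmetric_exists : exists g : bbilinear M, is_bmetric g.
Proof.
have [rho [g [lg cover]]] := locally_finite_family.
(* Near a point where [rho k > 0], the factor [k] vanishes as soon as
   [n%:R * rho k >= 1]; this makes the sum locally finite.  The first [n] with
   [rho n p > 0] has [w n p > 0], so the sum is definite. *)
pose w n q := \prod_(k < n) expinv 0 (1 - n%:R * rho k q).
have w_ge0 n q : 0 <= w n q by apply: prodr_ge0 => k _; exact: expinv_ge0.
have sw n c q : dom c q -> bsmooth c q (w n).
  move=> cq; apply: bsmooth_prod => k _; apply: bsmooth_expinv.
  apply: bsmoothB; first exact: bsmooth_cst.
  by apply: bsmoothM; [exact: bsmooth_cst|case: (lg k) => _ + _ _; exact].
have fin p : exists n0, \forall q \near p, forall n, (n0 <= n)%N -> w n q = 0.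
  have [k rk] := cover p.
  have [c cp] := bm_cover p.
  have [_ sr _ _] := lg k.
  have nr : \forall q \near p, rho k p / 2 < rho k q.
    apply: (near_gt (bsmooth_continuous cp (sr c p cp))).
    by rewrite ltr_pdivrMr// ltr_pMr// ltr1n.
  have [m mP] : exists m : nat, (rho k p / 2)^-1 < m%:R.
    by exists (Num.bound ((rho k p / 2)^-1)); apply: archi_boundP; rewrite invr_ge0 divr_ge0// ltW.
  (* [k.+1] makes [k] occur among the factors of [w n]; [m] makes [n%:R * rho k q] at least [1], as
     [rho k q] exceeds [rho k p / 2] near [p]. *)
  exists (maxn m k.+1); apply: filterS nr => q rq n.
  rewrite geq_max => /andP[mn kn]; rewrite /w (bigD1 (Ordinal kn))//= expinv_eq0 ?mul0r//.
  rewrite subr_le0.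
  have r2 : 0 < rho k p / 2 by rewrite divr_gt0.
  rewrite -[leLHS](mulVf (lt0r_neq0 r2)) ler_pM ?invr_ge0 ?(ltW r2)//; last exact: ltW.
  by rewrite (le_trans (ltW mP))// ler_nat.
have /choice [N NP] := fin.
(* The cut-off [N q] varies with [q]; [sumE] replaces it by any index past which the weights vanish,
   so that near [p] the sum has the fixed length [N p]. *)
pose G : bbilinear M := fun c q => \sum_(n < N q) w n q *: g n c q.
have sumE c q m : (forall n, (m <= n)%N -> w n q = 0) ->
    G c q = \sum_(n < m) w n q *: g n c q.
  move=> wm; have wN := nbhs_singleton (NP q).
  have ext m1 m2 : (forall n, (m1 <= n)%N -> w n q = 0) -> (m1 <= m2)%N ->
      \sum_(n < m2) w n q *: g n c q = \sum_(n < m1) w n q *: g n c q.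
    move=> w1 m12; rewrite -!(big_mkord xpredT (fun n => w n q *: g n c q)).
    have z : \sum_(m1 <= n < m2) w n q *: g n c q = 0.
      rewrite big_nat_cond big1// => n /andP[/andP[m1n _] _].
      by rewrite w1// scale0r.
    by rewrite (big_cat_nat (leq0n m1) m12) /= z addr0.
  rewrite /G -(ext (N q) (maxn (N q) m))// ?leq_maxl//.
  by rewrite (ext m)// leq_maxr.
exists G; split.
- move=> c i j; apply/smooth_inP => p cp.
  apply: (@bsmooth_eq _ _ _ _ (fun q => \sum_(n < N p) w n q * g n c q i j)).
    apply: filterS (NP p) => q wq; rewrite (sumE c q (N p) wq) summxE.
    by apply: eq_bigr => n _; rewrite mxE.
  apply: bsmooth_sum => n _; apply: bsmoothM; first exact: sw.
  by case: (lg n) => _ _ + _; exact.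
- move=> c p cp; rewrite /G linear_sum /=; apply: eq_bigr => n _.
  by rewrite linearZ /=; case: (lg n) => _ _ _ [-> //].
- move=> c p cp v v0.
  have GE : (v^T *m G c p *m v) 0 0 = \sum_(n < N p) w n p * (v^T *m g n c p *m v) 0 0.
    rewrite /G mulmx_sumr mulmx_suml summxE; apply: eq_bigr => n _.
    by rewrite -scalemxAr -scalemxAl mxE.
  have ge0 n : 0 <= (v^T *m g n c p *m v) 0 0 by case: (lg n) => _ _ _ [_ + _ _]; exact.
  rewrite GE.
  have ex : exists n, 0 < rho n p := cover p.
  pose k := ex_minn ex.
  have [k1 k2] : 0 < rho k p /\ forall n, (n < k)%N -> rho n p = 0.
    rewrite /k; case: ex_minnP => m m0 mmin; split=> // n nm.
    apply/eqP; rewrite eq_le; case: (lg n) => -> _ _ _; rewrite andbT leNgt.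
    by apply/negP => /mmin; rewrite leqNgt nm.
  (* For [n < k] the function [rho n] vanishes at [p], so every factor is [expinv 0 1]. *)
  have wk : 0 < w k p.
    apply: prodr_gt0 => n _; rewrite k2 ?ltn_ord// mulr0 subr0 expinv_gt0.
    exact: ltr01.
  have kN : (k < N p)%N.
    rewrite ltnNge; apply/negP => /(nbhs_singleton (NP p)) wk0.
    by rewrite wk0 ltxx in wk.
  rewrite (bigD1 (Ordinal kN))//=; apply: ltr_wpDr.
    by apply: sumr_ge0 => n _; rewrite mulr_ge0.
  by rewrite mulr_gt0//; case: (lg k) => _ _ _ [_ _ + _]; exact.
- move=> c c' p cp c'p nZ; rewrite /G mulmx_sumr mulmx_suml; apply: eq_bigr => n _.
  rewrite -scalemxAr -scalemxAl; congr (_ *: _).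
  by case: (lg n) => _ _ _ [_ _ _ +]; exact.
Qed.

End MetricExistence.

(** * Forms in a frame *)

Section Tuples.
Local Notation I := 'I_3.
Implicit Types (i j k : I).

Lemma tuple1E (T : Type) (s : 1.-tuple T) : s = [tuple thead s].
Proof. by case/tupleP: s => i s; rewrite theadE (tuple0 s); exact/val_inj. Qed.

Lemma tuple2_ind (T : Type) (P : 2.-tuple T -> Prop) :
  (forall x y : T, P [tuple x; y]) -> forall s, P s.
Proof.
move=> h s; case/tupleP: s => i s; case/tupleP: s => j s; rewrite (tuple0 s).
by have := h i j; congr P; exact/val_inj.
Qed.

Lemma tuple3_ind (T : Type) (P : 3.-tuple T -> Prop) :
  (forall x y z : T, P [tuple x; y; z]) -> forall s, P s.
Proof.
move=> h s; case/tupleP: s => i s; case/tupleP: s => j s; case/tupleP: s => k s.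
by rewrite (tuple0 s); have := h i j k; congr P; exact/val_inj.
Qed.

Lemma big_tupleS (T : finType) (V : nmodType) n (F : n.+1.-tuple T -> V) :
  \sum_(r : n.+1.-tuple T) F r = \sum_i \sum_(t : n.-tuple T) F [tuple of i :: t].
Proof.
rewrite pair_big /= (reindex (fun x : T * n.-tuple T => [tuple of x.1 :: x.2])) //.
exists (fun t : n.+1.-tuple T => (thead t, [tuple of behead t])) => [[i t] _|t _] /=.
  by congr pair; exact/val_inj.
by rewrite -tuple_eta.
Qed.

Lemma big_tuple0 (T : finType) (V : nmodType) (F : 0.-tuple T -> V) :
  \sum_(r : 0.-tuple T) F r = F [tuple].
Proof.
rewrite (big_pred1 [tuple]) // => t; by rewrite (tuple0 t) /= eqxx.
Qed.

Lemma big_tuple1 (V : nmodType) (F : 1.-tuple I -> V) :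
  \sum_(r : 1.-tuple I) F r = \sum_i F [tuple i].
Proof.
by rewrite big_tupleS; apply: eq_bigr => i _; rewrite big_tuple0; congr F; exact/val_inj.
Qed.

Lemma big_tuple3 (V : nmodType) (F : 3.-tuple I -> V) :
  \sum_(r : 3.-tuple I) F r = \sum_i \sum_j \sum_k F [tuple i; j; k].
Proof.
rewrite big_tupleS; apply: eq_bigr => i _; rewrite big_tupleS; apply: eq_bigr => j _.
by rewrite big_tupleS; apply: eq_bigr => k _; rewrite big_tuple0; congr F; exact/val_inj.
Qed.

Lemma cons_tuple1 i j : [tuple of i :: [tuple j]] = [tuple i; j].
Proof. exact/val_inj. Qed.

Lemma cons_tuple2 i j k : [tuple of i :: [tuple j; k]] = [tuple i; j; k].
Proof. exact/val_inj. Qed.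

Lemma ord2P (P : 'I_2 -> Prop) : P 0 -> P 1 -> forall a, P a.
Proof.
move=> P0 P1 [[|[|//]] Hi].
- by rewrite (_ : Ordinal _ = 0) //; exact/val_inj.
- by rewrite (_ : Ordinal _ = 1) //; exact/val_inj.
Qed.

Lemma omit2 i j : omit [tuple i; j] 0 = [tuple j] /\ omit [tuple i; j] 1 = [tuple i].
Proof. by split; apply: eq_from_tnth => b; rewrite tnth_mktuple ord1. Qed.

Lemma omit3 i j k : [/\ omit [tuple i; j; k] 0 = [tuple j; k],
  omit [tuple i; j; k] 1 = [tuple i; k] & omit [tuple i; j; k] 2 = [tuple i; j]].
Proof. by split; apply: eq_from_tnth; apply: ord2P; rewrite tnth_mktuple. Qed.

Section Alternation.
Variables (R : realType) (w : 3.-tuple I -> R).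

Definition alternating := forall s (sg : 'S_3),
  w [tuple tnth s (sg a) | a < 3] = (-1) ^+ sg * w s.

Lemma alternating_swap : alternating ->
  (forall i j k, w [tuple j; i; k] = - w [tuple i; j; k]) /\
  (forall i j k, w [tuple i; k; j] = - w [tuple i; j; k]).
Proof.
move=> alt; split=> i j k.
  have := alt [tuple i; j; k] (tperm 0 1); rewrite odd_tperm expr1 mulN1r => <-.
  congr w; apply: eq_from_tnth; apply: ord3P; by rewrite tnth_mktuple permE.
have := alt [tuple i; j; k] (tperm 1 2); rewrite odd_tperm expr1 mulN1r => <-.
congr w; apply: eq_from_tnth; apply: ord3P; by rewrite tnth_mktuple permE.
Qed.

Lemma alternating_rep : alternating ->
  (forall i j, w [tuple i; i; j] = 0) /\ (forall i j, w [tuple i; j; j] = 0) /\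
  (forall i j, w [tuple i; j; i] = 0).
Proof.
move=> /alternating_swap[w01 w12].
have w00 i j : w [tuple i; i; j] = 0 by have := w01 i i j; lra.
split=> //; split=> i j; first by have := w12 i j j; lra.
by rewrite w12 w00 oppr0.
Qed.

Lemma alternating_eq0 : alternating -> w [tuple 0; 1; 2] = 0 -> forall s, w s = 0.
Proof.
move=> alt e012; have [w01 w12] := alternating_swap alt.
have [w00 [w11 w02]] := alternating_rep alt.
have e021 : w [tuple 0; 2; 1] = 0 by rewrite w12 e012 oppr0.
have e102 : w [tuple 1; 0; 2] = 0 by rewrite w01 e012 oppr0.
have e120 : w [tuple 1; 2; 0] = 0 by rewrite w12 e102 oppr0.
have e201 : w [tuple 2; 0; 1] = 0 by rewrite w01 e021 oppr0.
have e210 : w [tuple 2; 1; 0] = 0 by rewrite w01 e120 oppr0.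
apply: tuple3_ind; apply: ord3P; apply: ord3P; apply: ord3P;
  first [assumption | exact: w00 | exact: w11 | exact: w02].
Qed.

(** A permutation is a product of transpositions. On three places the two adjacent ones are given,
    and the outer one is a composite of three of these, so it changes the sign as well. *)
Lemma swap_alternating :
  (forall i j k, w [tuple j; i; k] = - w [tuple i; j; k]) ->
  (forall i j k, w [tuple i; k; j] = - w [tuple i; j; k]) -> alternating.
Proof.
move=> w01 w12 s sg.
have w02 i j k : w [tuple k; j; i] = - w [tuple i; j; k].
  by rewrite w01 w12 w01 opprK.
have tp x y : x != y -> forall s, w [tuple tnth s (tperm x y a) | a < 3] = - w s.
  move=> xy; apply: tuple3_ind => i j k; move: x y xy.
  have e x y (t : 3.-tuple I) : (forall a, tnth [tuple i; j; k] (tperm x y a) = tnth t a) ->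
      w [tuple tnth [tuple i; j; k] (tperm x y a) | a < 3] = w t.
    by move=> h; congr w; apply: eq_from_tnth => a; rewrite tnth_mktuple.
  apply: ord3P; apply: ord3P => // _.
  - by rewrite (e _ _ [tuple j; i; k]); [exact: w01|apply: ord3P; rewrite permE].
  - by rewrite (e _ _ [tuple k; j; i]); [exact: w02|apply: ord3P; rewrite permE].
  - by rewrite (e _ _ [tuple j; i; k]); [exact: w01|apply: ord3P; rewrite permE].
  - by rewrite (e _ _ [tuple i; k; j]); [exact: w12|apply: ord3P; rewrite permE].
  - by rewrite (e _ _ [tuple k; j; i]); [exact: w02|apply: ord3P; rewrite permE].
  - by rewrite (e _ _ [tuple i; k; j]); [exact: w12|apply: ord3P; rewrite permE].
have [ts -> dts] := prod_tpermP sg.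
elim: ts dts s => [_|[x y] ts IH /= /andP[xy dts]] s.
  rewrite big_nil odd_perm1 expr0 mul1r; congr w.
  by apply: eq_from_tnth => a; rewrite tnth_mktuple perm1.
rewrite big_cons /=; set pi := (\prod_(t <- ts) tperm t.1 t.2)%g.
rewrite odd_permM odd_tperm xy.
rewrite (_ : [tuple _ | a < 3] =
    [tuple tnth [tuple tnth s (pi b) | b < 3] (tperm x y a) | a < 3]); last first.
  by apply: eq_from_tnth => a; rewrite !tnth_mktuple permM.
by rewrite tp// IH// signr_addb expr1 mulN1r mulNr.
Qed.

End Alternation.
End Tuples.

(** * Forms and their exterior derivative under a change of frame *)

Section Forms.
Variables (R : realType) (M : bmanifold3 R).
Local Notation E := 'rV[R]_3.
Local Notation C := (chart M).
Implicit Types (c d : C) (p q : M) (i j k : 'I_3) (al : bcoef M 1) (be : bcoef M 2).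

Lemma sum2E (V : zmodType) (f : 'I_2 -> V) : \sum_i f i = f 0 + f 1.
Proof. by rewrite !big_ord_recl big_ord0 addr0; congr (f _ + f _); exact/val_inj. Qed.

Lemma bd1E al c p i j : bd al c p [tuple i; j] =
  bderiv c i (fun q => al c q [tuple j]) p - bderiv c j (fun q => al c q [tuple i]) p.
Proof.
rewrite /bd sum2E expr0 expr1 mul1r mulN1r.
by rewrite (omit2 i j).1 (omit2 i j).2.
Qed.

Lemma bd1C al c p i j : bd al c p [tuple j; i] = - bd al c p [tuple i; j].
Proof. by rewrite !bd1E opprB. Qed.

Lemma bd2E be c p i j k : bd be c p [tuple i; j; k] =
  bderiv c i (fun q => be c q [tuple j; k]) p
  - bderiv c j (fun q => be c q [tuple i; k]) p
  + bderiv c k (fun q => be c q [tuple i; j]) p.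
Proof.
rewrite /bd sum3E expr0 expr1 mul1r mulN1r.
by have [-> -> ->] := omit3 i j k; rewrite -signr_odd expr0 mul1r.
Qed.

Lemma bwedgeE al be c p i j k : bwedge1 al be c p [tuple i; j; k] =
  al c p [tuple i] * be c p [tuple j; k] - al c p [tuple j] * be c p [tuple i; k]
  + al c p [tuple k] * be c p [tuple i; j].
Proof.
rewrite /bwedge1 sum3E expr0 expr1 mul1r mulN1r mulNr.
by have [-> -> ->] := omit3 i j k; rewrite -signr_odd expr0 mul1r.
Qed.

Lemma binterior1E (X : bvector M) be c p j :
  binterior X be c p [tuple j] = \sum_i X c p i 0 * be c p [tuple i; j].
Proof. by apply: eq_bigr => i _; rewrite cons_tuple1. Qed.

Lemma binterior2E (X : bvector M) (mu : bcoef M 3) c p j k :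
  binterior X mu c p [tuple j; k] = \sum_i X c p i 0 * mu c p [tuple i; j; k].
Proof. by apply: eq_bigr => i _; rewrite cons_tuple2. Qed.

Lemma bform1_overlap al c d p j : is_bform al -> dom c p -> dom d p -> ~ hypersurface p ->
  al c p [tuple j] = \sum_i al d p [tuple i] * btransition c d p i j.
Proof.
move=> [_ _ ov] cp dp nZ; rewrite (ov c d p cp dp nZ) big_tuple1.
by apply: eq_bigr => i _; rewrite big_ord1.
Qed.

Lemma bform_bsmooth n (w : bcoef M n) c p s : is_bform w -> dom c p ->
  bsmooth c p (fun q => w c q s).
Proof. by move=> [sw _ _] cp; move: (sw c s) => /smooth_inP; exact. Qed.

(* Row [i] of the transition matrix holds the coefficients of the closed form
   [dx'_i] (of [dt'/t'] if [i = 0]). *)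
Lemma btransition_closed c d p i j k : dom c p -> dom d p -> ~ hypersurface p ->
  bderiv c k (fun q => btransition c d q i j) p = bderiv c j (fun q => btransition c d q i k) p.
Proof.
move=> cp dp nZ.
pose y q := phi d q 0 i.
have sy : bsmooth c p y by exact: bsmooth_transition.
have sw : bsmooth c p (fun q => (bweight d i q)^-1).
  apply: bsmoothV; first exact: bweight_offZ.
  by apply: (bsmooth_change cp dp); exact: bsmooth_bweight.
have E l : \forall q \near p, (bweight d i q)^-1 * bderiv c l y q = btransition c d q i l.
  by apply: filterS (dom_near cp) => q cq; rewrite btransitionE.
have sE l : bsmooth c p (fun q => (bweight d i q)^-1 * bderiv c l y q).
  by apply: bsmoothM => //; exact: bsmooth_bderiv.
rewrite -(bderiv_near k cp (sE j) (E j)) -(bderiv_near j cp (sE k) (E k)).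
have sD l : bsmooth c p (bderiv c l y) by exact: bsmooth_bderiv.
apply: etrans (bderivM k cp sw (sD j)) _.
apply: etrans (esym (bderivM j cp sw (sD k))).
apply: (congr2 +%R); first exact: (congr1 ( *%R _) (bderivC k j cp sy)).
(* What is left is the wedge of [d(1/weight)] with [dy]. It vanishes because the weight is constant
   or equal to [y] itself. *)
have [i0|i0] := eqVneq i ord0; last first.
  have -> : (fun q : M => (bweight d i q)^-1) = cst 1.
    by apply/funext => q; rewrite /bweight (negbTE i0) invr1.
  by rewrite !bderiv_cst !mulr0.
have y0 : y p != 0 by have := bweight_offZ i dp nZ; rewrite /bweight /y i0 eqxx.
have DV l : bderiv c l (fun q => (bweight d i q)^-1) p = - (y p)^-1 * (y p)^-1 * bderiv c l y p.
  have -> : (fun q : M => (bweight d i q)^-1) = (fun q => (y q)^-1).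
    by apply/funext => q; rewrite /bweight /y i0.
  have sv : bsmooth c p (fun q => (y q)^-1) by exact: bsmoothV.
  have n1 : \forall q \near p, y q * (y q)^-1 = cst 1 q.
    by apply: filterS (near_neq0 (bsmooth_continuous cp sy) y0) => q; exact: mulfV.
  have := bderiv_near l cp (bsmoothM sy sv) n1; rewrite bderivM// bderiv_cst => /eqP.
  rewrite addrC addr_eq0 => /eqP h; apply: (mulfI y0); rewrite -[LHS]opprK -h; field.
  exact: y0.
by rewrite !DV mulrCA (mulrC (bderiv c j y p)) mulrCA.
Qed.

(** Differentiating the transformation rule of [al] gives terms with derivatives of its
    coefficients, which form the pulled-back [d alpha], and terms with derivatives of the transition
    matrix, which cancel in the antisymmetrisation by [btransition_closed]. *)
Lemma bd_overlap al c d p j k : is_bform al -> dom c p -> dom d p -> ~ hypersurface p ->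
  bd al c p [tuple k; j] = \sum_l \sum_i bd al d p [tuple l; i] *
    (btransition c d p l k * btransition c d p i j).
Proof.
move=> fal cp dp nZ.
pose a i q := al d q [tuple i].
have sa i : bsmooth d p (a i) by exact: bform_bsmooth.
have sac i : bsmooth c p (a i) by exact: bsmooth_change dp _.
have sB i l : bsmooth c p (fun q => btransition c d q i l).
  have [B sB BE] := btransition_ext i l cp dp.
  by apply: bsmooth_eq sB; apply: filterS2 BE (offZ_near nZ) => q h /h.
have Dk m l : bderiv c m (fun q => al c q [tuple l]) p =
    \sum_i (a i p * bderiv c m (fun q => btransition c d q i l) p
    + btransition c d p i l * \sum_n bderiv d n (a i) p * btransition c d p n m).
  have n1 : \forall q \near p, al c q [tuple l] =
      a 0 q * btransition c d q 0 l + a 1 q * btransition c d q 1 l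
      + a 2 q * btransition c d q 2 l.
    apply: filterS3 (dom_near cp) (dom_near dp) (offZ_near nZ) => q cq dq nZq.
    by rewrite (bform1_overlap l fal cq dq nZq) sum3E.
  rewrite (bderiv_near m cp (bform_bsmooth _ fal cp) n1).
  have sM i := bsmoothM (sac i) (sB i l).
  rewrite bderivD ?bderivD ?bderivM//; last exact: bsmoothD.
  by rewrite [RHS]sum3E -!(bderiv_chain m cp dp nZ).
rewrite bd1E !Dk -sumrB.
rewrite (eq_bigr (fun i => \sum_l bderiv d l (a i) p *
    (btransition c d p l k * btransition c d p i j
     - btransition c d p l j * btransition c d p i k))); last first.
  move=> i _; rewrite (btransition_closed i k j cp dp nZ).
  rewrite opprD addrACA subrr add0r !mulr_sumr -sumrB; apply: eq_bigr => l _; ring.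
under [RHS]eq_bigr do under eq_bigr do rewrite bd1E mulrBl.
under [RHS]eq_bigr do rewrite sumrB.
rewrite sumrB [X in _ = X - _]exchange_big /= -sumrB.
apply: eq_bigr => i _; rewrite -sumrB; apply: eq_bigr => l _.
rewrite -/(a _); ring.
Qed.

End Forms.

(** * Beltrami and Reeb fields *)

Lemma prod3E (R : comRingType) (f : 'I_3 -> R) : \prod_i f i = f 0 * f 1 * f 2.
Proof.
rewrite !big_ord_recl big_ord0 mulr1 mulrA.
by congr (f _ * f _ * f _); exact/val_inj.
Qed.

(** Compatibility of the wedge product with pullback, as a polynomial identity; [x], [y] and [z]
    stand for columns of the transition matrix. *)
Lemma wedge_pullback (R : comRingType) (a : 'I_3 -> R) (b : 'I_3 -> 'I_3 -> R)
    (x y z : 'I_3 -> R) :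
  (\sum_i a i * x i) * (\sum_i \sum_j b i j * (y i * z j))
  - (\sum_i a i * y i) * (\sum_i \sum_j b i j * (x i * z j))
  + (\sum_i a i * z i) * (\sum_i \sum_j b i j * (x i * y j))
  = \sum_i \sum_j \sum_k (a i * b j k - a j * b i k + a k * b i j) * (x i * y j * z k).
Proof. rewrite !sum3E; ring. Qed.

Section BeltramiReeb.
Variables (R : realType) (M : bmanifold3 R).
Local Notation E := 'rV[R]_3.
Local Notation C := (chart M).
Implicit Types (c d : C) (p q : M) (i j k : 'I_3) (al : bcoef M 1) (X : bvector M)
  (g : bbilinear M) (mu : bcoef M 3).

Lemma mulmx_bsmooth (l m n : nat) c p (A : M -> 'M[R]_(l, m)) (B : M -> 'M[R]_(m, n)) :
  (forall a b, bsmooth c p (fun q => A q a b)) ->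
  (forall a b, bsmooth c p (fun q => B q a b)) ->
  forall a b, bsmooth c p (fun q => (A q *m B q) a b).
Proof.
move=> sA sB a b; have : bsmooth c p (fun q => \sum_e A q a e * B q e b).
  by apply: bsmooth_sum => e _; exact: bsmoothM.
by apply: bsmooth_eq; apply: (@nearW _ (nbhs p)) => q; rewrite mxE.
Qed.

Lemma trmx_bsmooth (m n : nat) c p (A : M -> 'M[R]_(m, n)) :
  (forall a b, bsmooth c p (fun q => A q a b)) -> forall a b, bsmooth c p (fun q => (A q)^T a b).
Proof.
by move=> sA a b; apply: bsmooth_eq (sA b a); apply: (@nearW _ (nbhs p)) => q; rewrite mxE.
Qed.

Lemma bvector_bsmooth X c p : is_bvector_field X -> dom c p ->
  forall i (a : 'I_1), bsmooth c p (fun q => X c q i a).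
Proof.
move=> [sX _] cp i a; rewrite ord1; move: (sX c i) => /smooth_inP; exact.
Qed.

Lemma bmetric_bsmooth g c p : is_bmetric g -> dom c p ->
  forall i j, bsmooth c p (fun q => g c q i j).
Proof. by move=> [sg _ _ _] cp i j; move: (sg c i j) => /smooth_inP; exact. Qed.

Lemma smooth_bsmooth (h : M -> R) c p : smooth h -> dom c p -> bsmooth c p h.
Proof. by move=> sh cp; move: (sh c) => /smooth_inP; exact. Qed.

Lemma is_bform1P al :
  (forall c p i, dom c p -> bsmooth c p (fun q => al c q [tuple i])) ->
  on_overlaps (fun c d p => forall j,
    al c p [tuple j] = \sum_i al d p [tuple i] * btransition c d p i j) ->
  is_bform al.
Proof.
move=> sal ov; split.
- by move=> c s; rewrite (tuple1E s); apply/smooth_inP => p cp; exact: sal.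
- move=> c p s sg _; have -> : sg = 1%g by apply/permP => a; rewrite !ord1.
  rewrite odd_perm1 expr0 mul1r; congr al.
  by apply: eq_from_tnth => a; rewrite tnth_mktuple perm1.
- move=> c d p cp dp nZ s; rewrite (tuple1E s) (ov c d p cp dp nZ) big_tuple1.
  by apply: eq_bigr => i _; rewrite big_ord1.
Qed.

Lemma flatE g X c p i : flat g X c p [tuple i] = ((X c p)^T *m g c p) 0 i.
Proof. by rewrite /flat theadE. Qed.

Lemma flat_bform g X : is_bmetric g -> is_bvector_field X -> is_bform (flat g X).
Proof.
move=> gm Xv; apply: is_bform1P => [c p i cp|c d p cp dp nZ j].
  have := mulmx_bsmooth (trmx_bsmooth (bvector_bsmooth Xv cp))
    (bmetric_bsmooth gm cp) 0 i.
  by apply: bsmooth_eq; apply: (@nearW _ (nbhs p)) => q; rewrite flatE.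
have [_ _ _ gov] := gm; have [_ Xov] := Xv.
have -> : \sum_i flat g X d p [tuple i] * btransition c d p i j
    = ((X d p)^T *m g d p *m btransition c d p) 0 j.
  by rewrite [RHS]mxE; apply: eq_bigr => i _; rewrite flatE.
by rewrite flatE (gov c d p cp dp nZ) (Xov c d p cp dp nZ) trmx_mul !mulmxA.
Qed.

Definition metric_sq g X c p : R := ((X c p)^T *m g c p *m X c p) 0 0.

Lemma bpairing_flat g X c p : bpairing (flat g X) X c p = metric_sq g X c p.
Proof. by rewrite /metric_sq [RHS]mxE; apply: eq_bigr => i _; rewrite flatE. Qed.

(** The values in two charts agree off [Z] by the transformation rules and on [Z] by continuity, so
    a chart may be picked at each point. *)
Lemma metric_sq_function g X : is_bmetric g -> is_bvector_field X ->
  exists2 h : M -> R, smooth h & forall c p, dom c p -> h p = metric_sq g X c p.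
Proof.
move=> gm Xv.
have sq c p : dom c p -> bsmooth c p (metric_sq g X c).
  move=> cp; apply: (mulmx_bsmooth (mulmx_bsmooth _ _) _ 0 0).
  - exact: trmx_bsmooth (bvector_bsmooth Xv cp).
  - exact: bmetric_bsmooth.
  - exact: bvector_bsmooth.
have agree c d p : dom c p -> dom d p -> metric_sq g X c p = metric_sq g X d p.
  move=> cp dp; apply: agree_offZ.
  - exact: bsmooth_continuous (sq c p cp).
  - exact: bsmooth_continuous (sq d p dp).
  - apply: filterS2 (dom_near cp) (dom_near dp) => q cq dq nZ.
    have [_ _ _ gov] := gm; have [_ Xov] := Xv.
    by rewrite /metric_sq (gov c d q cq dq nZ) (Xov c d q cq dq nZ) trmx_mul !mulmxA.
have [ch chP] := choice (@bm_cover _ M).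
exists (fun p => metric_sq g X (ch p) p); last by move=> c p cp; exact: agree.
move=> c; apply/smooth_inP => p cp; apply: bsmooth_eq (sq c p cp).
by apply: filterS (dom_near cp) => q cq; exact: agree.
Qed.

Lemma bvf_scale_field (h : M -> R) X : smooth h -> is_bvector_field X ->
  is_bvector_field (bvf_scale h X).
Proof.
move=> sh Xv; split=> [c i|c d p cp dp nZ].
  apply/smooth_inP => p cp.
  apply: bsmooth_eq (bsmoothM (smooth_bsmooth sh cp) (bvector_bsmooth Xv cp i 0)).
  by apply: (@nearW _ (nbhs p)) => q; rewrite mxE.
by have [_ Xov] := Xv; rewrite /bvf_scale (Xov c d p cp dp nZ) -scalemxAr.
Qed.

Lemma smoothV (h : M -> R) : smooth h -> nowhere_zero h -> smooth (fun p => (h p)^-1).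
Proof.
by move=> sh h0 c; apply/smooth_inP => p cp; apply: bsmoothV => //; exact: smooth_bsmooth.
Qed.

Lemma beltrami_reeb X : is_bvector_field X -> bvf_nonvanishing X ->
  (exists g mu, is_bmetric g /\ is_bvolume mu /\ rotational_beltrami g mu X) ->
  exists al (Ral : bvector M) (h : M -> R),
    bcontact al /\ is_reeb al Ral /\ smooth h /\ nowhere_zero h /\ bvf_eq X (bvf_scale h Ral).
Proof.
move=> Xv X0 [g [mu [gm [[muf mu0] [_ [f [sf f0 dal _]]]]]]].
have [h sh hE] := metric_sq_function gm Xv.
have h0 p : h p != 0.
  have [c cp] := bm_cover p; rewrite (hE c p cp) gt_eqF//.
  by have [_ _ gpos _] := gm; apply: gpos => //; exact: X0.
have dE c p i j : dom c p ->
    bd (flat g X) c p [tuple i; j] = f p * \sum_l X c p l 0 * mu c p [tuple l; i; j].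
  by move=> cp; rewrite (dal c p cp) /bscale binterior2E.
have muA c p : dom c p -> alternating (mu c p).
  by move=> cp s sg; case: muf => _ + _; exact.
have pairE c p : dom c p -> \sum_i flat g X c p [tuple i] * X c p i 0 = h p.
  by move=> cp; rewrite (hE c p cp) -bpairing_flat.
exists (flat g X), (bvf_scale (fun p => (h p)^-1) X), h.
split; last split; last by split=> //; split=> // c p cp;
  rewrite /bvf_scale scalerA divff ?scale1r.
- split; first exact: flat_bform.
  (* In dimension three an alternating form of top degree is determined by this one coefficient, so
     that of [mu] is nonzero by [alternating_eq0]. *)
  move=> c p cp; exists [tuple 0; 1; 2].
  have [w01 w12] := alternating_swap (muA c p cp).
  have [w00 [_ w02]] := alternating_rep (muA c p cp).
  have m0 : mu c p [tuple 0; 1; 2] != 0.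
    apply/eqP => /(alternating_eq0 (muA c p cp)) mu00.
    by have [s] := mu0 c p cp; rewrite mu00 eqxx.
  have := pairE c p cp; rewrite bwedgeE !dE// !sum3E !w00 !w02.
  rewrite (w01 0 1 2) (w01 0 2 1) (w12 0 1 2) => E1.
  rewrite (_ : _ + _ = f p * h p * mu c p [tuple 0; 1; 2]).
    by rewrite !mulf_neq0.
  rewrite -E1; ring.
- split.
  + exact: bvf_scale_field (smoothV sh h0) Xv.
  + move=> c p cp s; rewrite (tuple1E s); set j := thead s.
    have [w01 w12] := alternating_swap (muA c p cp).
    have [w00 _] := alternating_rep (muA c p cp).
    rewrite binterior1E /bzero; under eq_bigr do rewrite dE// mxE.
    rewrite !sum3E !w00 (w01 0 1 j) (w01 0 2 j) (w01 1 2 j); ring.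
  + move=> c p cp; rewrite /bpairing -[RHS](mulVf (h0 p)) -(pairE c p cp) mulr_sumr.
    by apply: eq_bigr => i _; rewrite mxE mulrCA (pairE c p cp).
Qed.

(** * From a Reeb field to a Beltrami field *)

Section Converse.
Variables (al : bcoef M 1) (Ral : bvector M) (h : M -> R).
Hypotheses (fal : is_bform al) (Rv : is_bvector_field Ral) (sh : smooth h)
  (h0 : nowhere_zero h).
Hypothesis reeb1 : forall c p, dom c p -> bpairing al Ral c p = 1.
Hypothesis reeb0 : bform_eq (binterior Ral (bd al)) (@bzero R M 1).

Let w := bwedge1 al (bd al).

Let sal c p i : dom c p -> bsmooth c p (fun q => al c q [tuple i]).
Proof. by move=> cp; exact: bform_bsmooth. Qed.

Lemma bsmooth_bd1 c p i j : dom c p -> bsmooth c p (fun q => bd al c q [tuple i; j]).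
Proof.
move=> cp; have := bsmoothB (bsmooth_bderiv i cp (sal j cp)) (bsmooth_bderiv j cp (sal i cp)).
by apply: bsmooth_eq; apply: (@nearW _ (nbhs p)) => q; rewrite bd1E.
Qed.

(** Alternation comes from the two adjacent swaps and the antisymmetry of [d alpha], the
    transformation rule from [bd_overlap] and [wedge_pullback]. *)
Lemma wedge_bform : is_bform w.
Proof.
split.
- move=> c; apply: tuple3_ind => i j k; apply/smooth_inP => p cp.
  have s1 := bsmoothM (sal i cp) (bsmooth_bd1 j k cp).
  have s2 := bsmoothM (sal j cp) (bsmooth_bd1 i k cp).
  have s3 := bsmoothM (sal k cp) (bsmooth_bd1 i j cp).
  apply: bsmooth_eq (bsmoothD (bsmoothB s1 s2) s3).
  by apply: (@nearW _ (nbhs p)) => q; rewrite /w bwedgeE.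
- move=> c p s sg _; apply: swap_alternating => i j k; rewrite /w !bwedgeE.
    by rewrite (bd1C al c p i j); ring.
  by rewrite (bd1C al c p j k); ring.
- move=> c d p cp dp nZ; apply: tuple3_ind => i j k.
  rewrite big_tuple3 /w bwedgeE !(bd_overlap _ _ fal cp dp nZ).
  rewrite !(bform1_overlap _ fal cp dp nZ) wedge_pullback.
  do 3!(apply: eq_bigr => ? _).
  by rewrite bwedgeE prod3E.
Qed.

(** By continuity a nowhere zero [h] keeps its sign near each point, so the jump of [Num.sg] at [0]
    is never met. *)
Let sgh c p : dom c p -> \forall q \near p, Num.sg (h q) = Num.sg (h p).
Proof.
move=> cp; have ch := bsmooth_continuous cp (smooth_bsmooth sh cp).
have [hp|hp|hp] := ltgtP (h p) 0; last by have := h0 p; rewrite hp eqxx.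
  have := near_gt (continuousN ch) (_ : 0 < - h p); rewrite oppr_gt0 => /(_ hp).
  by apply: filterS => q; rewrite oppr_gt0 => hq; rewrite !ltr0_sg.
have := near_gt ch hp.
by apply: filterS => q hq; rewrite !gtr0_sg.
Qed.

Lemma smooth_sg : smooth (fun p => Num.sg (h p)).
Proof.
move=> c; apply/smooth_inP => p cp; apply: bsmooth_eq (bsmooth_cst c p (Num.sg (h p))).
by apply: filterS (sgh cp) => q ->.
Qed.

Definition row_of c p : 'rV[R]_3 := \row_j al c p [tuple j].

Definition kerproj c p : 'M[R]_3 := 1%:M - Ral c p *m row_of c p.

(** The coefficient is [1/|h|], written so that its smoothness follows from [smooth_sg] and
    [smoothV]. It is positive for either sign of [h], and its product with [h] is the sign of
    [h]. *)
Definition adapted_metric (g0 : bbilinear M) : bbilinear M := fun c p =>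
  (Num.sg (h p) * (h p)^-1) *: ((row_of c p)^T *m row_of c p)
  + (kerproj c p)^T *m g0 c p *m kerproj c p.

Lemma row_of_reeb c p : dom c p -> row_of c p *m Ral c p = 1%:M.
Proof.
move=> cp; apply/matrixP => a b; rewrite !ord1 !mxE eqxx -(reeb1 cp).
by apply: eq_bigr => i _; rewrite mxE.
Qed.

Lemma kerproj_reeb c p : dom c p -> kerproj c p *m Ral c p = 0.
Proof. by move=> cp; rewrite mulmxBl mul1mx -mulmxA row_of_reeb// mulmx1 subrr. Qed.

Lemma row_of_overlap c d p : dom c p -> dom d p -> ~ hypersurface p ->
  row_of c p = row_of d p *m btransition c d p.
Proof.
move=> cp dp nZ; apply/rowP => j; rewrite mxE [RHS]mxE (bform1_overlap j fal cp dp nZ).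
by apply: eq_bigr => i _; rewrite [row_of d p _ _]mxE.
Qed.

(** [R (x) alpha] is an endomorphism, as vectors and covectors transform oppositely; the
    intertwining form avoids inverting the transition matrix. *)
Lemma kerproj_overlap c d p : dom c p -> dom d p -> ~ hypersurface p ->
  btransition c d p *m kerproj c p = kerproj d p *m btransition c d p.
Proof.
move=> cp dp nZ; have [_ Rov] := Rv.
by rewrite mulmxBr mulmxBl mulmx1 mul1mx (Rov c d p cp dp nZ) -!mulmxA
  -(row_of_overlap cp dp nZ).
Qed.

Lemma adapted_metricP g0 : is_bmetric g0 -> is_bmetric (adapted_metric g0).
Proof.
move=> g0m.
have kpos p : 0 < Num.sg (h p) * (h p)^-1.
  have [hp|hp|hp] := ltgtP (h p) 0; last by have := h0 p; rewrite hp eqxx.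
    by rewrite ltr0_sg// mulN1r oppr_gt0 invr_lt0.
  by rewrite gtr0_sg// mul1r invr_gt0.
have srow c p : dom c p -> forall a j, bsmooth c p (fun q => row_of c q a j).
  move=> cp a j; apply: bsmooth_eq (sal j cp).
  by apply: (@nearW _ (nbhs p)) => q; rewrite mxE.
have sker c p : dom c p -> forall i j, bsmooth c p (fun q => kerproj c q i j).
  move=> cp i j; have := bsmoothB (bsmooth_cst c p ((1%:M : 'M[R]_3) i j))
    (mulmx_bsmooth (bvector_bsmooth Rv cp) (srow c p cp) i j).
  apply: bsmooth_eq; apply: (@nearW _ (nbhs p)) => q.
  by rewrite /kerproj [RHS]mxE; congr (_ + _); rewrite [RHS]mxE.
have [sg0 g0s g0pos g0ov] := g0m.
split.
- move=> c i j; apply/smooth_inP => p cp.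
  have s1 := bsmoothM (smooth_bsmooth smooth_sg cp) (smooth_bsmooth (smoothV sh h0) cp).
  have s2 := mulmx_bsmooth (trmx_bsmooth (srow c p cp)) (srow c p cp) i j.
  have s3 := mulmx_bsmooth (mulmx_bsmooth (trmx_bsmooth (sker c p cp))
    (bmetric_bsmooth g0m cp)) (sker c p cp) i j.
  apply: bsmooth_eq (bsmoothD (bsmoothM s1 s2) s3).
  apply: (@nearW _ (nbhs p)) => q.
  by rewrite /adapted_metric [RHS]mxE; congr (_ + _); rewrite [RHS]mxE.
- move=> c p cp; rewrite /adapted_metric linearD linearZ /= !trmx_mul !trmxK g0s//.
  by rewrite mulmxA.
- move=> c p cp v v0.
  have -> : (v^T *m adapted_metric g0 c p *m v) 0 0
      = Num.sg (h p) * (h p)^-1 * ((row_of c p *m v) 0 0) ^+ 2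
      + ((kerproj c p *m v)^T *m g0 c p *m (kerproj c p *m v)) 0 0.
    rewrite /adapted_metric (mulmxDr v^T) (mulmxDl _ _ v) mxE; congr (_ + _); last first.
      by rewrite trmx_mul !mulmxA.
    rewrite -scalemxAr -scalemxAl mxE; congr (_ * _).
    rewrite (_ : v^T *m _ *m v = (row_of c p *m v)^T *m (row_of c p *m v)); last first.
      by rewrite trmx_mul !mulmxA.
    by rewrite mxE big_ord1 mxE expr2.
  (* On [ker alpha] the projection is the identity and [g0] decides; elsewhere the first summand is
     positive and the second nonnegative. *)
  have [av|av] := eqVneq ((row_of c p *m v) 0 0) 0.
    rewrite av expr0n mulr0 add0r; apply: g0pos => //.
    have -> : kerproj c p *m v = v.
      rewrite mulmxBl mul1mx -mulmxA (_ : row_of c p *m v = 0) ?mulmx0 ?subr0//.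
      by apply/matrixP => a b; rewrite !ord1 av mxE.
    exact: v0.
  apply: ltr_wpDr; last by rewrite mulr_gt0// exprn_even_gt0.
  have [->|u0] := eqVneq (kerproj c p *m v) 0; last exact/ltW/g0pos.
  by rewrite mulmx0 mxE.
- move=> c d p cp dp nZ; rewrite /adapted_metric.
  rewrite (mulmxDr (btransition c d p)^T) (mulmxDl _ _ (btransition c d p)).
  congr (_ + _).
    rewrite -scalemxAr -scalemxAl; congr (_ *: _).
    by rewrite (row_of_overlap cp dp nZ) trmx_mul !mulmxA.
  rewrite (g0ov c d p cp dp nZ).
  transitivity ((btransition c d p *m kerproj c p)^T *m g0 d p
      *m (btransition c d p *m kerproj c p)).
    by rewrite trmx_mul !mulmxA.
  by rewrite kerproj_overlap// trmx_mul !mulmxA.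
Qed.

Lemma flat_adapted g0 c p i : dom c p ->
  flat (adapted_metric g0) (bvf_scale h Ral) c p [tuple i] = Num.sg (h p) * al c p [tuple i].
Proof.
move=> cp; rewrite flatE /bvf_scale /adapted_metric linearZ /= -scalemxAl (mulmxDr (Ral c p)^T).
rewrite -scalemxAr !mulmxA -!trmx_mul row_of_reeb// kerproj_reeb//.
rewrite trmx0 !mul0mx addr0 trmx1 mul1mx scalerA mulrCA mulfV// mulr1 !mxE.
by [].
Qed.

Lemma reeb_beltrami : bform_nowhere_zero w ->
  exists g mu, is_bmetric g /\ is_bvolume mu /\ rotational_beltrami g mu (bvf_scale h Ral).
Proof.
move=> w0; have [g0 g0m] := bmetric_exists M.
have R0 c p j : dom c p -> \sum_i Ral c p i 0 * bd al c p [tuple i; j] = 0.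
  by move=> cp; rewrite -binterior1E reeb0.
pose mu := bscale (fun p => (h p)^-1) w.
(* Contracting [alpha /\ d alpha] with [R] leaves [alpha(R) d alpha], since the two other terms
   contain [i_R d alpha = 0]; the factors [h] and [1/h] cancel. *)
have intE c p j k : dom c p ->
    binterior (bvf_scale h Ral) mu c p [tuple j; k] = bd al c p [tuple j; k].
  move=> cp; rewrite binterior2E /mu /bscale /bvf_scale.
  transitivity (\sum_i (al c p [tuple i] * Ral c p i 0 * bd al c p [tuple j; k]
    - al c p [tuple j] * (Ral c p i 0 * bd al c p [tuple i; k])
    + al c p [tuple k] * (Ral c p i 0 * bd al c p [tuple i; j]))).
    apply: eq_bigr => i _; rewrite mxE /w bwedgeE; field; exact: h0.
  rewrite big_split sumrB /= -mulr_suml -!mulr_sumr !R0// !mulr0 subr0 addr0.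
  by have := reeb1 cp; rewrite /bpairing => ->; rewrite mul1r.
exists (adapted_metric g0), mu; split; first exact: adapted_metricP.
split; last split.
- split; last first.
    move=> c p cp; have [s ws] := w0 c p cp; exists s.
    by rewrite /mu /bscale mulf_neq0// invr_eq0.
  have [sw aw ow] := wedge_bform; split.
  + move=> c s; apply/smooth_inP => p cp; apply: bsmoothM.
      exact: smooth_bsmooth (smoothV sh h0) cp.
    by move: (sw c s) => /smooth_inP; exact.
  + by move=> c p s sg cp; rewrite /mu /bscale aw// mulrCA.
  + move=> c d p cp dp nZ s; rewrite /mu /bscale (ow c d p cp dp nZ) mulr_sumr.
    by apply: eq_bigr => r _; rewrite mulrA.
- exact: bvf_scale_field.
- exists (fun p => Num.sg (h p)); split.
  + exact: smooth_sg.
  + by move=> p; rewrite sgr_eq0.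
  + move=> c p cp; apply: tuple2_ind => i j; rewrite /bscale intE//.
    (* Near [p] the sign of [h] is constant and passes through the derivative. *)
    have flatD k l : bderiv c k
        (fun q => flat (adapted_metric g0) (bvf_scale h Ral) c q [tuple l]) p
        = Num.sg (h p) * bderiv c k (fun q => al c q [tuple l]) p.
      have n1 : \forall q \near p, cst (Num.sg (h p)) q * al c q [tuple l]
          = flat (adapted_metric g0) (bvf_scale h Ral) c q [tuple l].
        by apply: filterS2 (dom_near cp) (sgh cp) => q cq sq; rewrite flat_adapted// sq.
      have sc := bsmooth_cst c p (Num.sg (h p)).
      rewrite -(bderiv_near k cp (bsmoothM sc (sal l cp)) n1).
      apply: etrans (bderivM k cp sc (sal l cp)) _.
      by rewrite bderiv_cst mulr0 addr0.
    by rewrite !bd1E !flatD mulrBr.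
  + move=> c p cp; apply: tuple3_ind => i j k; rewrite /bzero bd2E.
    have dE l m n : bderiv c l (fun q => binterior (bvf_scale h Ral) mu c q [tuple m; n]) p
        = bderiv c l (bderiv c m (fun q => al c q [tuple n])) p
        - bderiv c l (bderiv c n (fun q => al c q [tuple m])) p.
      have n1 : \forall q \near p, bderiv c m (fun q => al c q [tuple n]) q
          + - bderiv c n (fun q => al c q [tuple m]) q
          = binterior (bvf_scale h Ral) mu c q [tuple m; n].
        by apply: filterS (dom_near cp) => q cq; rewrite intE// bd1E.
      have s1 := bsmooth_bderiv m cp (sal n cp).
      have s2 := bsmooth_bderiv n cp (sal m cp).
      rewrite -(bderiv_near l cp (bsmoothB s1 s2) n1).
      apply: etrans (bderivD l cp s1 (bsmoothN s2)) _.
      by rewrite (bderivN l cp s2).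
    (* The six second derivatives of the coefficients of [alpha] cancel in pairs by [bderivC]. *)
    have alt6 (x y z x' y' z' : R) : x = x' -> y = y' -> z = z' ->
        x - y - (x' - z) + (y' - z') = 0 by move=> -> -> ->; ring.
    by rewrite !dE; apply: alt6; apply: bderivC => //; exact: sal.
Qed.

End Converse.

End BeltramiReeb.

Theorem theorem6p2 (R : realType) (M : bmanifold3 R) :
  (forall X : bvector M,
     is_bvector_field X ->
     bvf_nonvanishing X ->
     (exists (g : bbilinear M) (mu : bcoef M 3),
        is_bmetric g /\ is_bvolume mu /\ rotational_beltrami g mu X) ->
     exists (al : bcoef M 1) (Ral : bvector M) (h : M -> R),
       bcontact al /\ is_reeb al Ral /\
       smooth h /\ nowhere_zero h /\ bvf_eq X (bvf_scale h Ral))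
  /\
  (forall (al : bcoef M 1) (Ral : bvector M) (h : M -> R),
     bcontact al -> is_reeb al Ral ->
     smooth h -> nowhere_zero h ->
     exists (g : bbilinear M) (mu : bcoef M 3),
       is_bmetric g /\ is_bvolume mu /\
       rotational_beltrami g mu (bvf_scale h Ral)).
Proof.
split; first exact: beltrami_reeb.
move=> al Ral h [fal w0] [Rv reeb0 reeb1] sh h0.
exact: (reeb_beltrami fal Rv sh h0 reeb1 reeb0 w0).
Qed.
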